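(* For any integer $n\ge 6$, there exists $p_0\in(n-3,n-2)$ such that, for any $p\in(p_0,n-2)$, the map $u_0(x)=\frac{x}{\|x\|}$ does not minimize the functional $$\int_{\mathbf{B}^n} r^{2-p}\|\nabla u\|^2\,dx$$ among the maps $u\in W^{1,2}(\mathbf{B}^n,\mathbb{S}^{n-1})$ satisfying $u(x)=x$ on $\mathbb{S}^{n-1}$.
   Context: $\mathbf{B}^n$ is the Euclidean unit ball of $\mathbb{R}^n$, $\mathbb{S}^{n-1}$ its boundary sphere, $r=\|x\|$ the Euclidean norm of $x$. $W^{1,2}(\mathbf{B}^n,\mathbb{S}^{n-1})=\{u\in W^{1,2}(\mathbf{B}^n,\mathbb{R}^n): \|u\|=1 \text{ a.e.}\}$. The condition $u(x)=x$ on $\mathbb{S}^{n-1}$ is understood in the sense of traces. $\|\nabla u\|=\big(\sum_{i,j}|\partial u_i/\partial x_j|^2\big)^{1/2}$. *)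

(* Defs.v *)
From HB Require Import structures.
From mathcomp Require Import all_boot all_order all_algebra.
From mathcomp Require Import all_classical all_reals all_analysis.

Set Implicit Arguments.
Unset Strict Implicit.
Unset Printing Implicit Defensive.

Import Order.TTheory GRing.Theory Num.Theory.
Import numFieldNormedType.Exports.

Local Open Scope classical_set_scope.
Local Open Scope ring_scope.

Section rV_measurable.
Context {R : realType} (n : nat).

Definition rV_coord (i : 'I_n) (x : 'rV[R]_n) : measurableTypeR R := x ord0 i.

(* The sigma-algebra generated by the coordinates, i.e. the Borel
   sigma-algebra of R^n. *)
Let rV_measurable : set (set 'rV[R]_n) := g_sigma_preimage rV_coord.

Let rV_measurable0 : rV_measurable set0.
Proof. exact: sigma_algebra0. Qed.

Let rV_measurableC A : rV_measurable A -> rV_measurable (~` A).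
Proof. exact: sigma_algebraC. Qed.

Let rV_measurable_bigcup (F : _^nat) :
  (forall i, rV_measurable (F i)) -> rV_measurable (\bigcup_i F i).
Proof. exact: sigma_algebra_bigcup. Qed.

HB.instance Definition _ := @isMeasurable.Build default_measure_display
  'rV[R]_n rV_measurable rV_measurable0 rV_measurableC rV_measurable_bigcup.

Lemma measurable_rV_coord (i : 'I_n) : measurable_fun [set: 'rV[R]_n] (rV_coord i).
Proof.
move=> _ Y mY; rewrite setTI; apply: sub_sigma_algebra => /=.
rewrite -bigcup_seq/=; exists i => /=; first by rewrite mem_index_enum.
by exists Y => //; rewrite setTI.
Qed.

Lemma measurable_fun_rVP d (T : measurableType d) (f : T -> 'rV[R]_n) :
  (forall i, measurable_fun [set: T] (rV_coord i \o f)) ->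
  measurable_fun [set: T] f.
Proof.
move=> mf _ A mA; rewrite setTI.
have : (g_sigma_preimage (fun i => rV_coord i \o f) : set (set T)) `<=` measurable.
  apply: smallest_sub; first exact: sigma_algebra_measurable.
  rewrite -bigcup_seq/=; apply: bigcup_sub => i _ _ [B mB <-].
  exact: mf.
apply.
rewrite g_sigma_preimage_comp; exists A => //.
by rewrite setTI.
Qed.

End rV_measurable.

Section lebesgue_rV.
Context {R : realType}.

Definition rV_cons n (x : measurableTypeR R * 'rV[R]_n) : 'rV[R]_n.+1 :=
  \row_i (if unlift ord0 i is Some j then x.2 ord0 j else x.1).

Definition rV_uncons n (x : 'rV[R]_n.+1) : measurableTypeR R * 'rV[R]_n :=
  (x ord0 ord0, \row_j x ord0 (lift ord0 j)).

Lemma rV_cons0 n (x : measurableTypeR R * 'rV[R]_n) : rV_cons x ord0 ord0 = x.1.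
Proof. by rewrite mxE unlift_none. Qed.

Lemma rV_consS n (x : measurableTypeR R * 'rV[R]_n) j :
  rV_cons x ord0 (lift ord0 j) = x.2 ord0 j.
Proof. by rewrite mxE liftK. Qed.

Lemma rV_consK n : cancel (@rV_cons n) (@rV_uncons n).
Proof.
move=> [x v]; rewrite /rV_uncons rV_cons0; congr pair.
by apply/rowP => j; rewrite mxE rV_consS.
Qed.

Lemma rV_unconsK n : cancel (@rV_uncons n) (@rV_cons n).
Proof.
move=> x; apply/rowP => i; case: (unliftP ord0 i) => [j ->|->].
  by rewrite rV_consS mxE.
by rewrite rV_cons0.
Qed.

Lemma measurable_rV_cons n : measurable_fun setT (@rV_cons n).
Proof.
apply: measurable_fun_rVP => i; case: (unliftP ord0 i) => [j ->|->].
  rewrite (_ : _ \o _ = rV_coord j \o snd).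
    by apply: measurableT_comp => //; exact: measurable_rV_coord.
  by apply/funext => x /=; rewrite /rV_coord rV_consS.
rewrite (_ : _ \o _ = fst)//.
by apply/funext => x /=; rewrite /rV_coord rV_cons0.
Qed.

Lemma measurable_rV_uncons n : measurable_fun setT (@rV_uncons n).
Proof.
apply/measurable_fun_pair; first exact: measurable_rV_coord.
apply: measurable_fun_rVP => i.
rewrite (_ : _ \o _ = rV_coord (lift ord0 i)); first exact: measurable_rV_coord.
by apply/funext => x /=; rewrite /rV_coord mxE.
Qed.

HB.instance Definition _ n := isMeasurableFun.Build _ _ _ _ (@rV_cons n)
  (@measurable_rV_cons n).

Section cons_measure.
Local Open Scope ereal_scope.
Context n (mu : {sigma_finite_measure set 'rV[R]_n -> \bar R}).

Definition cons_measure : set 'rV[R]_n.+1 -> \bar R :=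
  pushforward (@lebesgue_measure R \x mu) (@rV_cons n).

Let cons_measure0 : cons_measure set0 = 0.
Proof. exact: measure0. Qed.

Let cons_measure_ge0 A : 0 <= cons_measure A.
Proof. exact: measure_ge0. Qed.

Let cons_measure_sigma_additive : semi_sigma_additive cons_measure.
Proof. exact: measure_semi_sigma_additive. Qed.

HB.instance Definition _ := isMeasure.Build _ _ _ cons_measure
  cons_measure0 cons_measure_ge0 cons_measure_sigma_additive.

Let cons_measure_sigma_finite : sigma_finite setT cons_measure.
Proof.
have /sigma_finiteP[F [TF ndF Foo]] := sigma_finiteT (@lebesgue_measure R).
have /sigma_finiteP[G [TG ndG Goo]] := sigma_finiteT mu.
exists (fun k => @rV_uncons n @^-1` (F k `*` G k)).
  rewrite -preimage_bigcup (_ : \bigcup_k _ = setT) ?preimage_setT//.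
  rewrite -setXTT TF TG predeqE => -[x y]; split.
    by move=> [k _ []/= ? ?]; split; exists k.
  move=> [/= [k _ Fkx] [l _ Gly]]; exists (maxn k l) => //; split.
  - by move: x Fkx; exact/subsetPset/ndF/leq_maxl.
  - by move: y Gly; exact/subsetPset/ndG/leq_maxr.
move=> k; have [mFk Fkoo] := Foo k; have [mGk Gkoo] := Goo k; split.
  by rewrite -[X in measurable X]setTI; apply: measurable_rV_uncons => //;
    exact: measurableX.
rewrite /cons_measure /pushforward -comp_preimage.
rewrite (_ : _ \o _ = id); last by apply/funext => x /=; rewrite rV_consK.
by rewrite preimage_id product_measure1E// lte_mul_pinfty// ge0_fin_numE.
Qed.

HB.instance Definition _ := Measure_isSigmaFinite.Build _ _ _ cons_measure
  cons_measure_sigma_finite.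

End cons_measure.

(* Lebesgue measure on R^n: the n-fold product of lebesgue_measure. *)
Fixpoint lebesgue_rV n : {sigma_finite_measure set 'rV[R]_n -> \bar R} :=
  if n is n'.+1 return {sigma_finite_measure set 'rV[R]_n -> \bar R}
  then cons_measure (lebesgue_rV n') else dirac (0 : 'rV[R]_0).

End lebesgue_rV.

Section weighted_energy.
Context {R : realType} {n : nat}.
Local Notation mu := (@lebesgue_rV R n).

(* The norm `|x| of the library on 'rV[R]_n is the sup norm. *)
Definition enorm (x : 'rV[R]_n) : R := Num.sqrt (\sum_(i < n) x ord0 i ^+ 2).

Definition unit_ball : set 'rV[R]_n := [set x | enorm x < 1].

Definition radial_proj (x : 'rV[R]_n) : 'rV[R]_n := (enorm x)^-1 *: x.

Definition partial (i : 'I_n) (f : 'rV[R]_n -> R) (x : 'rV[R]_n) : R :=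
  'D_(delta_mx ord0 i) f x.

(* f is of class C^k on the whole of R^n. *)
Fixpoint classC (k : nat) (f : 'rV[R]_n -> R) : Prop :=
  if k is k'.+1 then
    (forall x, differentiable f x) /\ (forall i, classC k' (partial i f))
  else continuous f.

(* C_c^oo of the unit ball, extended by 0. *)
Definition test_function (phi : 'rV[R]_n -> R) : Prop :=
  [/\ forall k, classC k phi,
      compact (closure [set x | phi x != 0]) &
      closure [set x | phi x != 0] `<=` unit_ball].

Definition L2_ball (f : 'rV[R]_n -> R) : Prop :=
  measurable_fun unit_ball f /\
  (\int[mu]_(x in unit_ball) (f x ^+ 2)%:E < +oo)%E.

Definition weak_gradient (f : 'rV[R]_n -> R) (Df : 'rV[R]_n -> 'rV[R]_n) : Prop :=
  forall (i : 'I_n) (phi : 'rV[R]_n -> R), test_function phi ->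
    \int[mu]_(x in unit_ball) (f x * partial i phi x) =
    - \int[mu]_(x in unit_ball) (Df x ord0 i * phi x).

(* f is in W^{1,2} of the ball with weak gradient Df. As Df is unique up to a
   null set, a Sobolev function is handled as the pair (f, Df). *)
Definition W12 (f : 'rV[R]_n -> R) (Df : 'rV[R]_n -> 'rV[R]_n) : Prop :=
  [/\ L2_ball f, forall i, L2_ball (fun x => Df x ord0 i) & weak_gradient f Df].

(* Integral over the unit sphere against the surface measure, in the form given by
   polar coordinates: the surface area of A is n times the volume of the cone
   {t x : x \in A, 0 < t < 1}. *)
Definition sphere_integral (g : 'rV[R]_n -> R) : \bar R :=
  (n%:R%:E * \int[mu]_(x in unit_ball) (g (radial_proj x))%:E)%E.

(* g is the trace on the unit sphere of the Sobolev function (f, Df): the trace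
   operator is the continuous extension, from W^{1,2} of the ball to L^2 of the
   sphere, of the restriction of C^1 functions to the sphere. *)
Definition has_trace (f : 'rV[R]_n -> R) (Df : 'rV[R]_n -> 'rV[R]_n)
    (g : 'rV[R]_n -> R) : Prop :=
  exists phi : nat -> 'rV[R]_n -> R,
  [/\ forall k, classC 1 (phi k),
      (\int[mu]_(x in unit_ball) ((phi k x - f x) ^+ 2)%:E)%E @[k --> \oo] --> 0%E,
      forall i, (\int[mu]_(x in unit_ball)
        ((partial i (phi k) x - Df x ord0 i) ^+ 2)%:E)%E @[k --> \oo] --> 0%E &
      sphere_integral (fun x => (phi k x - g x) ^+ 2) @[k --> \oo] --> 0%E].

(* Here and below Du x i j stands for the weak derivative d u_i / d x_j. *)
Definition W12_sphere (u : 'rV[R]_n -> 'rV[R]_n) (Du : 'rV[R]_n -> 'M[R]_n) : Prop :=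
  (forall i, W12 (fun x => u x ord0 i) (fun x => row i (Du x))) /\
  {ae mu, forall x, unit_ball x -> enorm (u x) = 1}.

Definition admissible (u : 'rV[R]_n -> 'rV[R]_n) (Du : 'rV[R]_n -> 'M[R]_n) : Prop :=
  W12_sphere u Du /\
  forall i, has_trace (fun x => u x ord0 i) (fun x => row i (Du x))
                      (fun x => x ord0 i).

Definition hs_norm (M : 'M[R]_n) : R :=
  Num.sqrt (\sum_(i < n) \sum_(j < n) `|M i j| ^+ 2).

Definition energy (p : R) (Du : 'rV[R]_n -> 'M[R]_n) : \bar R :=
  (\int[mu]_(x in unit_ball) (enorm x `^ (2 - p) * hs_norm (Du x) ^+ 2)%:E)%E.

(* (u0, Du0) minimizes the energy among the admissible maps. *)
Definition minimizes (p : R) (u0 : 'rV[R]_n -> 'rV[R]_n)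
    (Du0 : 'rV[R]_n -> 'M[R]_n) : Prop :=
  admissible u0 Du0 /\
  forall u Du, admissible u Du -> (energy p Du0 <= energy p Du)%E.

End weighted_energy.

(* Main.v *)
(* Let q = n - p, which lies in (2, 21/10). Rotate u0 = x/|x| towards a coordinate
   direction e_k: with f = (1 - |x|^2)^2 and c = x_k/|x|, consider the
   normalisation u_(k,s) of u0 + s f (e_k - c u0), which agrees with u0 on the
   sphere. Since u0 is critical only the terms in s^2 matter; adding the energies
   over both signs of s and over all k kills the odd powers of s, and
   sum_k c_k^2 = 1 removes the angular dependence, so that for m = n - 1
     sum_(k, +-) E(u_(k,s)) <= 2 n E(u0) + 2 m s^2 Q + O(s^4),
     Q = int r^(2-p) f'^2 - (n - 3) int r^(-p) f^2.
   The integrals int_B r^(2j-p) are n vol(B) / (q + 2j) (divergence theorem for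
   the fields r^a x), hence Q is a positive multiple of
   q (q + 2) - 3 (n - 3) < 0 (here 3 (n - 3) >= 9 > 2.1 * 4.1), and some
   u_(k,s) has less energy than u0.

   Everything is integrated by parts along coordinate lines, almost all of which
   miss the origin. Traces are obtained by replacing |x| with sqrt(|x|^2 + e)
   in u_(k,s) and letting e tend to 0. *)
Require Import Defs.
From HB Require Import structures.
From mathcomp Require Import all_boot all_order all_algebra.
From mathcomp Require Import all_classical all_reals all_analysis.
From mathcomp Require Import measurable_realfun ring lra.

Import Order.TTheory GRing.Theory Num.Theory.
Import numFieldNormedType.Exports.

Set Implicit Arguments.
Unset Strict Implicit.
Unset Printing Implicit Defensive.

Local Open Scope classical_set_scope.
Local Open Scope ring_scope.

(** * Boxes and Lebesgue measure *)

Section boxes.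
Context {R : realType}.

(** The square in f = (1 - |x|^2)^2 is what reaches n = 6. With 1 - |x|^2 in its place, Q would have
    the sign of q (q + 2) - 2 (n - 3), which is positive for n = 6 and n = 7 as soon as q > 2; the
    square improves 2 (n - 3) to 3 (n - 3). At n = 6 the condition q (q + 2) < 9 means q < sqrt 10 -
    1 = 2.16..., so 21/10 is a round number below this bound, and it serves all n >= 6 at once. The
    obstacle is the singularity at 0: the fields |x|^a x need not be differentiable there, and the
    integrability of |x|^a is itself to be proved. Powers of |x|^2 + e are therefore integrated
    first, with a bound uniform in e; letting e tend to 0 gives integrability, and only then does
    the same divergence identity at e = 0 give the exact values. The competitors are regularised by
    the same device. *)

Definition box n (A : 'I_n -> set (measurableTypeR R)) : set 'rV[R]_n :=
  [set x | forall i, A i (x ord0 i)].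

Lemma measurable_box n (A : 'I_n -> set (measurableTypeR R)) :
  (forall i, measurable (A i)) -> measurable (box A).
Proof.
move=> mA; rewrite (_ : box A = \big[setI/setT]_(i < n) (rV_coord i @^-1` A i)).
  apply: bigsetI_measurable => i _; rewrite -[X in measurable X]setTI.
  exact: measurable_rV_coord.
rewrite -bigcap_seq; apply/seteqP; split=> x /= Ax i; first by move=> _; exact: Ax.
by apply: Ax; rewrite /= mem_index_enum.
Qed.

(** Generalises [rV_cons] to an arbitrary position: for fixed [y], the points [row_ins i (t, y)] run
    over a line in direction i. *)
Definition row_ins n (i : 'I_n.+1) (z : measurableTypeR R * 'rV[R]_n) : 'rV[R]_n.+1 :=
  \row_j (if unlift i j is Some k then z.2 ord0 k else z.1).

Lemma row_ins_same n (i : 'I_n.+1) z : row_ins i z ord0 i = z.1.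
Proof. by rewrite mxE unlift_none. Qed.

Lemma row_ins_lift n (i : 'I_n.+1) z j : row_ins i z ord0 (lift i j) = z.2 ord0 j.
Proof. by rewrite mxE liftK. Qed.

Lemma preimage_row_ins_box n (i : 'I_n.+1) A :
  row_ins i @^-1` box A = A i `*` box (fun j => A (lift i j)).
Proof.
apply/seteqP; split => [z /= Az|z [/= Az1 Az2] j].
  split => [|j]; first by have := Az i; rewrite row_ins_same.
  by have := Az (lift i j); rewrite row_ins_lift.
by case: (unliftP i j) => [k ->|->]; rewrite (row_ins_lift, row_ins_same).
Qed.

Lemma measurable_row_ins n (i : 'I_n.+1) : measurable_fun setT (row_ins i).
Proof.
apply: measurable_fun_rVP => j; case: (unliftP i j) => [k ->|->].
  rewrite (_ : _ \o _ = rV_coord k \o snd).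
    by apply: measurableT_comp => //; exact: measurable_rV_coord.
  by apply/funext => x /=; rewrite /rV_coord row_ins_lift.
rewrite (_ : _ \o _ = fst)//.
by apply/funext => x /=; rewrite /rV_coord row_ins_same.
Qed.

HB.instance Definition _ n i := isMeasurableFun.Build _ _ _ _ (@row_ins n i)
  (@measurable_row_ins n i).

Lemma row_ins0 n : @row_ins n ord0 = @rV_cons R n.
Proof. by []. Qed.

Lemma lebesgue_rV_box n (A : 'I_n -> set (measurableTypeR R)) :
  (forall i, measurable (A i)) ->
  lebesgue_rV n (box A) = (\prod_(i < n) lebesgue_measure (A i))%E.
Proof.
elim: n A => [|n IH] A mA.
  rewrite big_ord0 /= diracE mem_set//= => -[] //.
rewrite /= /cons_measure /pushforward /= -row_ins0 preimage_row_ins_box.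
rewrite product_measure1E//; last by apply: measurable_box.
by rewrite big_ord_recl IH.
Qed.

Lemma setI_box n (A B : 'I_n -> set (measurableTypeR R)) :
  box A `&` box B = box (fun i => A i `&` B i).
Proof.
apply/seteqP; split => [x [Ax Bx] i|x ABx]; first by split; [exact: Ax|exact: Bx].
by split => i; have [] := ABx i.
Qed.

Definition boxes n : set (set 'rV[R]_n) :=
  [set B | exists2 A, (forall i, measurable (A i)) & B = box A].

(** Uniqueness of measures asks for a generating family stable under intersection; boxes are one,
    preimages under single coordinates are not. *)
Lemma measurable_rVE n : (measurable : set (set 'rV[R]_n)) = <<s @boxes n >>.
Proof.
apply/seteqP; split.
  apply: smallest_sub; first exact: smallest_sigma_algebra.
  rewrite -bigcup_seq/=; apply: bigcup_sub => i _ _ [B mB <-].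
  apply: sub_sigma_algebra.
  exists (fun j => if j == i then B else setT); first by move=> j; case: ifP.
  rewrite setTI; apply/seteqP; split => [x Bx j|x /(_ i)]; last by rewrite eqxx.
  by case: eqP => // ->.
apply: smallest_sub; first exact: sigma_algebra_measurable.
by move=> _ [A mA ->]; exact: measurable_box.
Qed.

(* Lebesgue measure is determined by its values on boxes, so the defining
   recursion, which peels off the first coordinate, may peel off any other. *)
Lemma lebesgue_rV_ins n (i : 'I_n.+1) (B : set 'rV[R]_n.+1) : measurable B ->
  lebesgue_rV n.+1 B = pushforward (@lebesgue_measure R \x lebesgue_rV n)%E (row_ins i) B.
Proof.
(* These cubes exhaust the space and have finite measure, as the uniqueness theorem requires. *)
pose g k : set 'rV[R]_n.+1 := box (fun=> `[- k%:R, k%:R]%classic).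
apply: (measure_unique (@boxes n.+1) g).
- exact: measurable_rVE.
- move=> _ _ [A mA ->] [B' mB' ->]; rewrite setI_box; exists (fun i => A i `&` B' i) => //.
  by move=> j; exact: measurableI.
- by move=> k; exists (fun=> `[- k%:R, k%:R]%classic).
- apply/seteqP; split => // x _.
  exists (Num.bound (\sum_j `|x ord0 j|)) => // j /=.
  rewrite in_itv/= -ler_norml.
  apply: le_trans (ltW (archi_boundP _)); last by apply: sumr_ge0.
  by rewrite (bigD1 j)//= lerDl; apply: sumr_ge0.
- move=> _ [A mA ->]; apply: (etrans (lebesgue_rV_box mA)).
  rewrite /= /pushforward/= preimage_row_ins_box.
  rewrite product_measure1E//; last by apply: measurable_box.
  by rewrite (bigD1_ord i)//= lebesgue_rV_box.
- move=> k; pose I : set (measurableTypeR R) := `[- k%:R, k%:R]%classic.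
  have mI (j : 'I_n.+1) : measurable I by exact: measurable_itv.
  apply: (eq_ind_r (fun z => z < +oo)%E _ (lebesgue_rV_box mI)).
  rewrite lebesgue_measure_itv/= lte_fin.
  elim: (n.+1) => [|m IH]; first by rewrite big_ord0 ltry.
  rewrite big_ord_recl lte_mul_pinfty//; 
    first by case: ifP => // _; rewrite -EFinB lee_fin; have := ler0n R k; lra.
  by case: ifP.
Qed.

End boxes.

Section measurable_cont.
Context {R : realType} {n : nat}.
Local Notation mu := (@lebesgue_rV R n).

(** The sigma-algebra comes from the coordinates, the topology from the sup norm, whose balls are
    cubes. An open set is the union of the cubes with rational centre and half-side 1/(k+1) that it
    contains, and [pickle] enumerates these. *)
Lemma open_measurable_rV (A : set 'rV[R]_n) : open A -> measurable A.
Proof.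
move=> oA.
pose cube (qk : 'rV[rat]_n * nat) : set 'rV[R]_n :=
  box (fun i => `]ratr (qk.1 ord0 i) - qk.2.+1%:R^-1, ratr (qk.1 ord0 i) + qk.2.+1%:R^-1[%classic).
pose F m := if unpickle m is Some qk then
  if `[< cube qk `<=` A >] then cube qk else set0 else set0.
rewrite (_ : A = \bigcup_m F m).
  apply: bigcup_measurable => m _; rewrite /F; case: unpickle => // qk.
  by case: ifP => // _; apply: measurable_box => i; exact: measurable_itv.
apply/seteqP; split => [x Ax|x [m _]]; last first.
  rewrite /F; case: unpickle => // qk; case: ifPn => // /asboolP; exact.
have /nbhs_ballP[e /= e0 xeA] : nbhs x A by exact: open_nbhs_nbhs.
(* Half of [e], because a point of the chosen cube is compared with [x] through the rational centre,
   each of the two distances being below 1/(k+1). *)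
have [k ke] : exists k, k.+1%:R^-1 < e / 2 :> R.
  have e2 : 0 < e / 2 by lra.
  exists (Num.bound (e / 2)^-1); rewrite invf_plt ?posrE//.
  apply: (lt_le_trans (archi_boundP _)); first by rewrite invr_ge0 ltW.
  by rewrite ler_nat.
have k0 : 0 < k.+1%:R^-1 :> R by rewrite invr_gt0.
have /choice[q qP] : forall i,
    exists q : rat, ratr q \in `]x ord0 i - k.+1%:R^-1, x ord0 i + k.+1%:R^-1[.
  move=> i; apply: rat_in_itvoo; move: k0; set a := (k.+1%:R)^-1; move=> a0.
  by rewrite ltrBlDr -addrA ltrDl addr_gt0.
have qx i : `|x ord0 i - ratr (q i)| < k.+1%:R^-1.
  by have := qP i; rewrite in_itv/= distrC ltr_distl.
have cx : cube (\row_i q i, k) x.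
  move=> i /=; rewrite mxE in_itv/= -ltr_distl; exact: qx.
exists (pickle (\row_i q i : 'rV[rat]_n, k)) => //.
rewrite /F pickleK ifT//; apply/asboolP => y cy; apply: xeA; split=> // i j.
rewrite ord1 /ball/=; have := cy j; rewrite /= mxE in_itv/= -ltr_distl => yq.
rewrite (_ : _ - _ = (x ord0 j - ratr (q j)) - (y ord0 j - ratr (q j))); last by ring.
apply: (le_lt_trans (ler_normB _ _)); rewrite [e]splitr.
by rewrite ltrD// (lt_trans _ ke).
Qed.

Lemma continuous_measurable_rV (f : 'rV[R]_n -> R) : continuous f ->
  measurable_fun setT f.
Proof.
move=> cf; apply: (measurability _ (measurable_realfun.RGenOpens.measurableE R)).
move=> _ [_ [a [b ->] <-]]; rewrite setTI; apply: open_measurable_rV.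
by move/continuousP : cf; apply; exact: interval_open.
Qed.
End measurable_cont.

(** * The unit ball *)

Section ball.
Context {R : realType} {n : nat}.
Local Notation mu := (@lebesgue_rV R n).
Implicit Types x y : 'rV[R]_n.

(** The square of [enorm]. Being a polynomial it is differentiable at 0 as well, so the calculus is
    done with it. *)
Definition sqnorm x : R := \sum_(i < n) x ord0 i ^+ 2.

Lemma sqnorm_ge0 x : 0 <= sqnorm x.
Proof. by apply: sumr_ge0 => i _; exact: sqr_ge0. Qed.

Lemma sqnorm_eq0 x : (sqnorm x == 0) = (x == 0).
Proof.
apply/eqP/eqP => [/eqP|->]; last by rewrite /sqnorm big1// => i _; rewrite mxE expr0n.
rewrite psumr_eq0 => [/allP x0|i _]; last exact: sqr_ge0.
apply/rowP => i; rewrite mxE; apply/eqP; rewrite -sqrf_eq0.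
by have /implyP := x0 i (mem_index_enum _); apply.
Qed.

Lemma sqnorm_gt0 x : (0 < sqnorm x) = (x != 0).
Proof. by rewrite lt_neqAle sqnorm_ge0 andbT eq_sym sqnorm_eq0. Qed.

Lemma le_sqr_sqnorm x i : x ord0 i ^+ 2 <= sqnorm x.
Proof. by rewrite /sqnorm (bigD1 i)//= lerDl sumr_ge0// => j _; exact: sqr_ge0. Qed.

Lemma unit_ballE : unit_ball = [set x | sqnorm x < 1].
Proof.
apply/seteqP; split => x; rewrite /unit_ball /enorm /= -/(sqnorm x).
  by rewrite -[X in _ < X]sqrtr1 ltr_sqrt.
by rewrite -[X in _ -> _ < X]sqrtr1 ltr_sqrt.
Qed.

Lemma measurable_coord (i : 'I_n) (D : set 'rV[R]_n) : measurable_fun D (fun x => x ord0 i).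
Proof. by apply: measurable_funTS; exact: measurable_rV_coord. Qed.

Lemma measurable_sqnorm (D : set 'rV[R]_n) : measurable_fun D sqnorm.
Proof.
by apply: measurable_sum => i; apply: measurable_funX; exact: measurable_coord.
Qed.

Lemma measurable_unit_ball : measurable (@unit_ball R n).
Proof.
rewrite unit_ballE -[X in measurable X]setTI.
rewrite (_ : [set x | _] = sqnorm @^-1` `]-oo, 1[%classic).
  by apply: measurable_sqnorm.
by apply/seteqP; split => x; rewrite /= in_itv.
Qed.

Lemma unit_ball_sub_box : (@unit_ball R n) `<=` box (fun=> `[-1, 1]%classic).
Proof.
rewrite unit_ballE => x /= x1 i /=; rewrite in_itv/= -ler_norml.
by rewrite -(@expr_le1 _ 2)// real_normK ?num_real// (le_trans (le_sqr_sqnorm x i))// ltW.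
Qed.

Lemma finite_unit_ball : (mu unit_ball < +oo)%E.
Proof.
have mI (j : 'I_n) : measurable (`[-1, 1]%classic : set (measurableTypeR R)).
  exact: measurable_itv.
apply: (@le_lt_trans _ _ (mu (box (fun=> `[-1, 1]%classic)))).
  apply: le_measure; rewrite ?inE; first exact: measurable_unit_ball.
    exact: measurable_box.
  exact: unit_ball_sub_box.
apply: (eq_ind_r (fun z => z < +oo)%E _ (lebesgue_rV_box mI)).
rewrite lebesgue_measure_itv/= lte_fin.
elim: {mI}n => [|m IH]; first by rewrite big_ord0 ltry.
by rewrite big_ord_recl lte_mul_pinfty//; case: ifP => // _; rewrite -EFinB ?lee_fin; lra.
Qed.

Lemma unit_ball_gt0 : (0 < mu unit_ball)%E.
Proof.
(* A cube of side 1/(n+1) fits into the ball: each squared coordinate is at most [a], and n/(n+1) <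
   1, also for n = 0. *)
pose a : R := (n.+1%:R)^-1.
have a0 : 0 < a by rewrite invr_gt0.
have mI (j : 'I_n) : measurable (`[0, a]%classic : set (measurableTypeR R)).
  exact: measurable_itv.
apply: (@lt_le_trans _ _ (mu (box (fun=> `[0, a]%classic)))).
  apply: (eq_ind_r (fun z => 0 < z)%E _ (lebesgue_rV_box mI)).
  rewrite lebesgue_measure_itv/= lte_fin a0 oppr0 adde0.
  rewrite big_const_ord; elim: n => [|m IH] /=; first by rewrite lte_fin.
  by rewrite mule_gt0.
apply: le_measure; rewrite ?inE; [exact: measurable_box|exact: measurable_unit_ball|].
rewrite unit_ballE => x xa /=.
apply: (@le_lt_trans _ _ (\sum_(i < n) a)).
  apply: ler_sum => i _; have /= := xa i; rewrite in_itv/= => /andP[x0 xia].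
  have a1 : a <= 1 by rewrite invf_le1// ler1n.
  by rewrite expr2; apply: (le_trans _ xia); rewrite ler_piMl// (le_trans xia).
by rewrite sumr_const card_ord -mulr_natl ltr_pdivrMr// mul1r ltr_nat.
Qed.

End ball.

(** Stated for [n.+1] because in dimension 0 the measure is the Dirac mass at the origin. *)
Lemma lebesgue_rV_origin (R : realType) (n : nat) : lebesgue_rV n.+1 [set (0 : 'rV[R]_n.+1)] = 0%E.
Proof.
have mI (j : 'I_n.+1) : measurable ([set 0] : set (measurableTypeR R)) by [].
rewrite (_ : [set 0] = box (fun=> [set 0])).
  by apply: (etrans (lebesgue_rV_box mI)); rewrite big_ord_recl lebesgue_measure_set1 mul0e.
apply/seteqP; split => [x -> i|x x0]/=; first by rewrite mxE.
by apply/rowP => i; rewrite mxE; exact: x0.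
Qed.

Lemma measurable_rV_origin (R : realType) (n : nat) : measurable [set 0 : 'rV[R]_n].
Proof.
rewrite (_ : [set 0] = box (fun=> [set 0])); first exact: measurable_box.
apply/seteqP; split => [x -> i|x x0]/=; first by rewrite mxE.
by apply/rowP => i; rewrite mxE; exact: x0.
Qed.

(** * Integration by parts along coordinate lines *)

Section ibp.
Context {R : realType} {n : nat}.
Variable i : 'I_n.+2.
Implicit Types (y : 'rV[R]_n.+1) (x : 'rV[R]_n.+2).

Lemma integrable_row_ins (F : 'rV[R]_n.+2 -> \bar R) :
  (lebesgue_rV n.+2).-integrable setT F ->
  (@lebesgue_measure R \x lebesgue_rV n.+1)%E.-integrable setT (F \o row_ins i).
Proof.
move=> /integrableP[mF iF]; apply/integrableP; split; first exact: measurableT_comp.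
apply: le_lt_trans iF.
have E := @ge0_integral_pushforward _ _ _ _ R _ (@measurable_row_ins R n.+1 i)
  (@lebesgue_measure R \x lebesgue_rV n.+1)%E setT (abse \o F).
have -> : (\int[lebesgue_rV n.+2]_x `|F x| =
    \int[pushforward (@lebesgue_measure R \x lebesgue_rV n.+1)%E (row_ins i)]_x `|F x|)%E.
  by apply: eq_measure_integral => B mB _; exact: lebesgue_rV_ins.
have mF' : measurable_fun setT (abse \o F) by exact: measurableT_comp.
by rewrite (E measurableT mF') ?preimage_setT//; move=> y _; exact: abse_ge0.
Qed.

Lemma integral_row_ins (F : 'rV[R]_n.+2 -> \bar R) :
  (lebesgue_rV n.+2).-integrable setT F ->
  (\int[lebesgue_rV n.+2]_x F x =
   \int[lebesgue_rV n.+1]_y \int[lebesgue_measure]_t F (row_ins i (t, y)))%E.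
Proof.
move=> iF; have mF := measurable_int _ iF.
pose nu := pushforward (@lebesgue_measure R \x lebesgue_rV n.+1)%E (row_ins i).
transitivity (\int[nu]_x F x)%E.
  by apply: eq_measure_integral => B mB _; exact: lebesgue_rV_ins.
have iF' := integrable_row_ins iF.
rewrite /nu integral_pushforward ?preimage_setT//.
by rewrite -(integral21_prod_meas1 iF').
Qed.

Lemma sqnorm_row_ins t y : sqnorm (row_ins i (t, y)) = t ^+ 2 + sqnorm y.
Proof.
rewrite /sqnorm (bigD1_ord i)//= row_ins_same; congr (_ + _).
by apply: eq_bigr => j _; rewrite row_ins_lift.
Qed.

Lemma row_insD (h t : R) y :
  row_ins i (h + t, y) = h *: delta_mx ord0 i + row_ins i (t, y).
Proof.
apply/rowP => j; rewrite !mxE/=; case: (unliftP i j) => [k ->|->].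
  by rewrite eq_sym (negbTE (neq_lift _ _)) mulr0 add0r.
by rewrite eqxx mulr1.
Qed.

Lemma continuous_row_ins y : continuous (fun t : R => row_ins i (t, y)).
Proof.
rewrite (_ : (fun _ => _) = (fun t => t *: delta_mx ord0 i + row_ins i (0, y))).
  by move=> t; apply: cvgD; [apply: cvgZr_tmp; exact: cvg_id|exact: cvg_cst].
by apply/funext => t; rewrite -[in LHS](addr0 t); exact: row_insD.
Qed.

Lemma is_derive_row_ins (g : 'rV[R]_n.+2 -> R) (d : R) (t : R) y :
  is_derive (row_ins i (t, y)) (delta_mx ord0 i) g d ->
  is_derive t 1 (fun t => g (row_ins i (t, y))) d.
Proof.
move=> [dg <-].
pose q h := h^-1 *: ((g \o shift (row_ins i (t, y))) (h *: delta_mx ord0 i) - g (row_ins i (t, y))).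
have E : (fun h : R => h^-1 *: (((fun t => g (row_ins i (t, y))) \o shift t) (h *: 1) -
    g (row_ins i (t, y)))) = q.
  by apply/funext => h; rewrite /q/= -row_insD /GRing.scale/= mulr1.
by split; rewrite /derivable /derive E.
Qed.

(** The interval parametrises the chord that the line cuts out of the ball. Its end points lie on
    the sphere, where [g] vanishes, so the fundamental theorem of calculus gives 0; [y != 0] keeps
    the whole line away from the origin. *)
Lemma integral_line0 (g dg : 'rV[R]_n.+2 -> R) y : y != 0 -> sqnorm y < 1 ->
  (forall x, x != 0 -> is_derive x (delta_mx ord0 i) g (dg x)) ->
  (forall x, x != 0 -> {for x, continuous dg}) ->
  (forall x, sqnorm x = 1 -> g x = 0) ->
  (\int[lebesgue_measure]_(t in `](- Num.sqrt (1 - sqnorm y))%R, (Num.sqrt (1 - sqnorm y))%R[)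
    (dg (row_ins i (t, y)))%:E = 0)%E.
Proof.
move=> y0 y1 gdg cdg g0.
set s := Num.sqrt _; have s0 : 0 < s by rewrite sqrtr_gt0 subr_gt0.
have ins0 t : row_ins i (t, y) != 0.
  rewrite -sqnorm_gt0 sqnorm_row_ins ltr_wpDl ?sqr_ge0// sqnorm_gt0//.
have cl : continuous (fun t : R => dg (row_ins i (t, y))).
  by move=> t; apply: (@continuous_comp _ _ _ (fun t : R => row_ins i (t, y)) dg);
    [exact: continuous_row_ins|exact: cdg].
have dl (t : R) : is_derive t 1 (fun t : R => g (row_ins i (t, y))) (dg (row_ins i (t, y))).
  by apply: is_derive_row_ins; exact: gdg.
have cg : continuous (fun t : R => g (row_ins i (t, y))).
  by move=> t; apply/differentiable_continuous/derivable1_diffP; have [] := dl t.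
rewrite -(@integral_itv_bndoo _ _ _ _ true false); last first.
  apply/measurable_EFinP; apply: measurable_funTS.
  by apply: continuous_measurable_fun.
apply: (etrans (@continuous_FTC2 R (fun t : R => dg (row_ins i (t, y)))
  (fun t : R => g (row_ins i (t, y))) (- s) s _ _ _ _)).
- lra.
- exact: continuous_subspaceT.
- split => [t _||]; first by have [] := dl t.
    by apply: cvg_at_right_filter; exact: cg.
  by apply: cvg_at_left_filter; exact: cg.
- by move=> t _; rewrite derive1E; have [_ ->] := dl t.
- by rewrite !g0 ?subee// sqnorm_row_ins ?sqrrN sqr_sqrtr ?subr_ge0 ?ltW//; ring.
Qed.

(* For y != 0 the line through y in direction i misses the singularity at 0,
   and the hyperplane has dimension at least one, so almost all y are nonzero. *)
Lemma integral_partial0 (g dg : 'rV[R]_n.+2 -> R) :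
  (forall x, x != 0 -> is_derive x (delta_mx ord0 i) g (dg x)) ->
  (forall x, x != 0 -> {for x, continuous dg}) ->
  (forall x, sqnorm x = 1 -> g x = 0) ->
  (lebesgue_rV n.+2).-integrable unit_ball (EFin \o dg) ->
  (\int[lebesgue_rV n.+2]_(x in unit_ball) (dg x)%:E = 0)%E.
Proof.
move=> gdg cdg g0 idg.
have idg' : (lebesgue_rV n.+2).-integrable setT ((EFin \o dg) \_ unit_ball).
  by move: idg; rewrite integrable_mkcond//; exact: measurable_unit_ball.
rewrite integral_mkcond integral_row_ins//.
rewrite -[RHS](@integral0 _ _ _ (lebesgue_rV n.+1) setT); apply: ae_eq_integral => //.
  exact: (measurable_fubini_G (integrable_row_ins idg')).
exists [set (0 : 'rV[R]_n.+1)]; split; [exact: measurable_rV_origin|exact: lebesgue_rV_origin|].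
move=> y /= /not_implyP[_]; apply: contra_notP => /eqP y0 /=.
have [y1|y1] := ltP (sqnorm y) 1; last first.
  rewrite -[RHS](@integral0 _ _ _ (@lebesgue_measure R) setT); apply: eq_integral => t _.
  rewrite patchE unit_ballE memNset//.
  rewrite /= sqnorm_row_ins; have := sqr_ge0 t; lra.
rewrite -[RHS](integral_line0 y0 y1 gdg cdg g0) [RHS]integral_mkcond.
apply: eq_integral => t _; rewrite !patchE unit_ballE.
suff -> : (row_ins i (t, y) \in [set x | sqnorm x < 1]) =
  (t \in `]- Num.sqrt (1 - sqnorm y), Num.sqrt (1 - sqnorm y)[%classic) by [].
apply/idP/idP; rewrite !inE/= in_itv/= sqnorm_row_ins -ltr_norml -sqrtr_sqr ltr_sqrt; lra.
Qed.
End ibp.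

(** * Gradients *)

Section pointwise_continuity.
Context {R : realType} {T : topologicalType}.
Implicit Types (f g : T -> R) (x : T).

Lemma cont_cst (c : R) x : {for x, continuous (fun=> c)}.
Proof. exact: cvg_cst. Qed.

Lemma contD f g x : {for x, continuous f} -> {for x, continuous g} ->
  {for x, continuous (fun x => f x + g x)}.
Proof. by move=> cf cg; apply: (@cvgD _ _ _ (nbhs x) _ f g). Qed.

Lemma contN f x : {for x, continuous f} -> {for x, continuous (fun x => - f x)}.
Proof. by move=> cf; apply: (@cvgN _ _ _ (nbhs x) _ f). Qed.

Lemma contB f g x : {for x, continuous f} -> {for x, continuous g} ->
  {for x, continuous (fun x => f x - g x)}.
Proof. by move=> cf cg; apply: contD => //; exact: contN. Qed.

Lemma contM f g x : {for x, continuous f} -> {for x, continuous g} ->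
  {for x, continuous (fun x => f x * g x)}.
Proof. by move=> cf cg; apply: (@cvgM _ _ (nbhs x) _ f g). Qed.

Lemma contX f m x : {for x, continuous f} -> {for x, continuous (fun x => f x ^+ m)}.
Proof.
move=> cf; elim: m => [|m IH]; first exact: cont_cst.
rewrite (_ : (fun x => _) = (fun x => f x * f x ^+ m)); first exact: contM.
by apply/funext => y; rewrite exprS.
Qed.

Lemma cont_comp (h : R -> R) f x : {for f x, continuous h} -> {for x, continuous f} ->
  {for x, continuous (fun x => h (f x))}.
Proof. by move=> ch cf; apply: (@continuous_comp _ _ _ f h). Qed.

End pointwise_continuity.

Section gradient.
Context {R : realType} {n : nat}.
Implicit Types (f g : 'rV[R]_n -> R) (x : 'rV[R]_n) (df dg : 'I_n -> R).

(** Full differentiability is recorded beside the partial derivatives because the chain rule and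
    [classC] ask for it. The gradient is a plain function of the index, so that [has_grad_eq] can
    bring it into any form that [ring] or [field] confirms. *)
Definition has_grad f x df :=
  differentiable f x /\ forall j, 'D_(delta_mx ord0 j) f x = df j.

Lemma has_grad_is_derive f x df j : has_grad f x df ->
  is_derive x (delta_mx ord0 j) f (df j).
Proof. by move=> [dif fE]; split; [exact: diff_derivable|exact: fE]. Qed.

Lemma has_grad_eq f x df dg : has_grad f x df -> df =1 dg -> has_grad f x dg.
Proof. by move=> [dif fE] E; split => // j; rewrite fE. Qed.

Lemma has_grad_continuous f x df : has_grad f x df -> {for x, continuous f}.
Proof. by move=> [? _]; exact: differentiable_continuous. Qed.

Lemma cont_coord i x : {for x, continuous (fun x => x ord0 i)}.
Proof. exact/differentiable_continuous/differentiable_coord. Qed.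

Lemma has_grad_cst (c : R) x : has_grad (fun=> c) x (fun=> 0).
Proof.
split; first exact: differentiable_cst.
by move=> j; rewrite (_ : (fun=> c) = cst c)// derive_cst.
Qed.

Lemma has_grad_coord i x : has_grad (fun x => x ord0 i) x (fun j => (i == j)%:R).
Proof.
split=> [|j]; first exact: differentiable_coord.
rewrite /derive; apply/cvg_lim => //; apply: cvg_near_cst.
apply: filterS (nbhs_dnbhs_neq 0) => h h0.
by rewrite /= !mxE eqxx/= addrK eq_sym /GRing.scale/= mulKf.
Qed.

Lemma has_gradD f g x df dg : has_grad f x df -> has_grad g x dg ->
  has_grad (fun x => f x + g x) x (fun j => df j + dg j).
Proof.
move=> [dif fE] [dig gE]; split=> [|j]; first exact: differentiableD.
by rewrite deriveD ?fE ?gE//; exact: diff_derivable.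
Qed.

Lemma has_gradN f x df : has_grad f x df -> has_grad (fun x => - f x) x (fun j => - df j).
Proof.
move=> [dif fE]; split=> [|j]; first exact: differentiableN.
by rewrite deriveN ?fE//; exact: diff_derivable.
Qed.

Lemma has_gradB f g x df dg : has_grad f x df -> has_grad g x dg ->
  has_grad (fun x => f x - g x) x (fun j => df j - dg j).
Proof. by move=> hf hg; apply: has_gradD => //; exact: has_gradN. Qed.

Lemma has_gradM f g x df dg : has_grad f x df -> has_grad g x dg ->
  has_grad (fun x => f x * g x) x (fun j => f x * dg j + g x * df j).
Proof.
move=> [dif fE] [dig gE]; split=> [|j]; first exact: differentiableM.
by rewrite deriveM ?fE ?gE//; exact: diff_derivable.
Qed.

Lemma has_gradX f x df m : has_grad f x df ->
  has_grad (fun x => f x ^+ m) x (fun j => m%:R * f x ^+ m.-1 * df j).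
Proof.
move=> fdf; elim: m => [|m IH].
  under eq_fun do rewrite expr0.
  by apply: has_grad_eq (has_grad_cst _ _) _ => j; rewrite !mul0r.
under eq_fun do rewrite exprS.
apply: has_grad_eq (has_gradM fdf IH) _ => j /=.
case: m {IH} => [|m]; first by rewrite /= !expr0 !mul1r !mul0r mulr0 add0r.
rewrite /= !exprS -[in RHS]natr1. ring.
Qed.

Lemma has_grad_sum (m : nat) (F : 'I_m -> 'rV[R]_n -> R) x (dF : 'I_m -> 'I_n -> R) :
  (forall i, has_grad (F i) x (dF i)) ->
  has_grad (fun x => \sum_i F i x) x (fun j => \sum_i dF i j).
Proof.
elim: m F dF => [|m IH] F dF FdF.
  under eq_fun do rewrite big_ord0.
  by apply: has_grad_eq (has_grad_cst _ _) _ => j; rewrite big_ord0.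
under eq_fun do rewrite big_ord_recl.
by apply: has_grad_eq (has_gradD (FdF ord0) (IH _ _ (fun i => FdF _))) _ => j; rewrite big_ord_recl.
Qed.

Lemma has_grad_comp (h : R -> R) f x df dh : is_derive (f x) 1 h dh ->
  has_grad f x df -> has_grad (fun x => h (f x)) x (fun j => dh * df j).
Proof.
move=> [dih hE] [dif fE].
have dhf : differentiable h (f x) by exact/derivable1_diffP.
split=> [|j]; first exact: (differentiable_comp dif dhf).
rewrite deriveE; last exact: (differentiable_comp dif dhf).
rewrite (_ : (fun x => h (f x)) = h \o f)// diff_comp//=.
rewrite -(deriveE _ dif) fE.
(* The differential of [h] is linear on R: its value at [df j] is [df j] times its value at 1. *)
rewrite -[X in 'd h _ X]mulr1 -[X in 'd h _ X]/(df j *: (1 : R)) linearZ/=.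
by rewrite -(deriveE _ dhf) hE mulrC.
Qed.

Lemma has_grad_sqnorm x : has_grad (@sqnorm R n) x (fun j => 2 * x ord0 j).
Proof.
apply: (has_grad_eq (has_grad_sum (fun i => has_gradX 2 (has_grad_coord i x)))) => j /=.
rewrite (bigD1 j)//= eqxx mulr1 big1 ?addr0// => i /negbTE ->.
by rewrite mulr0.
Qed.

End gradient.

(** * Radial integrals *)

Section radial.
Context {R : realType} {n : nat}.
Local Notation mu := (@lebesgue_rV R n.+2).
Local Notation B := (@unit_ball R n.+2).
Local Notation N := (n.+2%:R : R).
Implicit Types (x : 'rV[R]_n.+2).

Lemma measurable_comp_sqnorm (h : R -> R) (D : set 'rV[R]_n.+2) : measurable_fun setT h ->
  measurable_fun D (fun x => h (sqnorm x)).
Proof. by move=> mh; apply: measurableT_comp => //; exact: measurable_sqnorm. Qed.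

Lemma continuous_sqnorm : continuous (@sqnorm R n.+2).
Proof. by move=> x; exact: has_grad_continuous (has_grad_sqnorm x). Qed.

(* The divergence of the field [h (|x|^2) x], which vanishes on the sphere. *)
Lemma integral_radial_div (h dh : R -> R) :
  (forall t : R, 0 < t -> is_derive t 1 h (dh t)) ->
  (forall t : R, 0 < t -> {for t, continuous dh}) ->
  h 1 = 0 -> measurable_fun setT h -> measurable_fun setT dh ->
  mu.-integrable B (EFin \o (fun x => h (sqnorm x))) ->
  mu.-integrable B (EFin \o (fun x => sqnorm x * dh (sqnorm x))) ->
  (\int[mu]_(x in B) (N * h (sqnorm x) + 2 * (sqnorm x * dh (sqnorm x)))%:E = 0)%E.
Proof.
move=> hdh cdh h1 mh mdh ih idh.
have mB := @measurable_unit_ball R n.+2.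
(* The i-th partial derivative of x_i h(|x|^2); the sum over i is the integrand of the statement. *)
pose dg (i : 'I_n.+2) x := h (sqnorm x) + 2 * (x ord0 i ^+ 2 * dh (sqnorm x)).
have i2 i : mu.-integrable B (EFin \o (fun x => x ord0 i ^+ 2 * dh (sqnorm x))).
  apply: le_integrable idh => //.
    apply/measurable_EFinP; apply: measurable_funM; last exact: measurable_comp_sqnorm.
    by apply: measurable_funX; exact: measurable_coord.
  move=> x _; rewrite /= lee_fin normrM [leRHS]normrM.
  rewrite (ger0_norm (sqr_ge0 _)) (ger0_norm (sqnorm_ge0 _)).
  by rewrite ler_wpM2r// le_sqr_sqnorm.
have idg : forall k, mu.-integrable B (EFin \o dg k).
  move=> k.
  have i3 := integrableZl mB 2 (i2 k).
  by apply: eq_integrable (integrableD mB ih i3) => // x _; rewrite /= EFinD EFinM.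
transitivity (\int[mu]_(x in B) \sum_(i < n.+2) (dg i x)%:E)%E.
  apply: eq_integral => x _; rewrite sumEFin; congr EFin; rewrite big_split/=.
  by rewrite sumr_const card_ord -mulr_sumr -mulr_suml [n.+2%:R * _]mulr_natl.
rewrite (integral_sum mB idg).
rewrite big1 => // k _.
apply: (@integral_partial0 R n k (fun x => x ord0 k * h (sqnorm x))) => //.
- move=> x; rewrite -sqnorm_gt0 => x0.
  have := has_gradM (has_grad_coord k x) (has_grad_comp (hdh _ x0) (has_grad_sqnorm x)).
  move/(has_grad_is_derive k); rewrite eqxx mulr1 /dg addrC.
  by rewrite (_ : _ * (_ * (2 * _)) = 2 * (x ord0 k ^+ 2 * dh (sqnorm x)))//; ring.
- move=> x; rewrite -sqnorm_gt0 => x0.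
  have ch : {for x, continuous (fun x => h (sqnorm x))}.
    exact: has_grad_continuous (has_grad_comp (hdh _ x0) (has_grad_sqnorm x)).
  have cd : {for x, continuous (fun x => dh (sqnorm x))}.
    apply: (@continuous_comp _ _ _ (@sqnorm R n.+2) dh); first exact: continuous_sqnorm.
    exact: cdh.
  apply: contD => //; apply: contM; first exact: cont_cst.
  by apply: contM => //; apply: contX; exact: cont_coord.
- by move=> x ->; rewrite h1 mulr0.
Qed.

End radial.

Section ball_integrability.
Context {R : realType} {n : nat}.
Local Notation mu := (@lebesgue_rV R n.+2).
Local Notation B := (@unit_ball R n.+2).
Local Notation N := (n.+2%:R : R).
Implicit Types (x : 'rV[R]_n.+2) (f g : 'rV[R]_n.+2 -> R).

Definition ball_integrable f := mu.-integrable B (EFin \o f).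

Let mB : measurable B := measurable_unit_ball.

Lemma ball_integrable_eq f g : {in B, f =1 g} -> ball_integrable f -> ball_integrable g.
Proof. by move=> fg; apply: eq_integrable => // x xB /=; rewrite fg. Qed.

Lemma ball_integrableD f g : ball_integrable f -> ball_integrable g ->
  ball_integrable (fun x => f x + g x).
Proof. by move=> intf intg; apply: eq_integrable (integrableD mB intf intg). Qed.

Lemma ball_integrableZ c f : ball_integrable f -> ball_integrable (fun x => c * f x).
Proof. by move=> intf; apply: eq_integrable (integrableZl mB c intf). Qed.

Lemma ball_integrable_le f g : measurable_fun B f ->
  (forall x, B x -> `|f x| <= g x) -> ball_integrable g -> ball_integrable f.
Proof.
move=> mf fg; apply: le_integrable => //; first exact/measurable_EFinP.
by move=> x Bx /=; rewrite lee_fin (le_trans (fg _ Bx))// ler_norm.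
Qed.

Lemma ball_integrable_cst c : ball_integrable (fun=> c).
Proof.
apply: measurable_bounded_integrable => //; first exact: finite_unit_ball.
by exists `|c|; split=> [|M cM x _]; [exact: num_real|exact: ltW].
Qed.

Lemma ball_integrable_bounded c f : measurable_fun B f ->
  (forall x, B x -> `|f x| <= c) -> ball_integrable f.
Proof. by move=> mf fc; apply: (ball_integrable_le mf fc); exact: ball_integrable_cst. Qed.

Definition vol : R := fine (mu B).

Lemma vol_gt0 : 0 < vol.
Proof. by apply: fine_gt0; rewrite unit_ball_gt0 finite_unit_ball. Qed.

End ball_integrability.

(** * Integrals of powers of |x|, by regularisation at the origin *)

Section power_integrals.
Context {R : realType} {n : nat}.
Local Notation mu := (@lebesgue_rV R n.+2).
Local Notation B := (@unit_ball R n.+2).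
Local Notation N := (n.+2%:R : R).
Implicit Types (x : 'rV[R]_n.+2) (f g : 'rV[R]_n.+2 -> R).

Let mB : measurable B := measurable_unit_ball.

Lemma is_derive_powRD (e a t : R) : 0 <= e -> 0 < t ->
  is_derive t 1 (fun t : R => (t + e) `^ a) (a * (t + e) `^ (a - 1)).
Proof.
move=> e0 t0; have te : 0 < t + e by lra.
rewrite -[X in is_derive _ _ _ X]mulr1.
apply: (@is_derive1_comp R (fun t : R => t `^ a) (fun t : R => t + e)).
  exact: is_derive1_powR.
by apply: is_derive_eq; rewrite addr0.
Qed.

Lemma continuous_powRD (e a t : R) : 0 <= e -> 0 < t ->
  {for t, continuous (fun t : R => (t + e) `^ a)}.
Proof.
move=> e0 t0; apply/differentiable_continuous/derivable1_diffP.
by have [] := is_derive_powRD a e0 t0.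
Qed.

Lemma measurable_powRD (e a : R) (D : set R) : measurable_fun D (fun t : R => (t + e) `^ a).
Proof.
apply: (measurableT_comp (f := fun t : R => t `^ a)); first exact: measurable_powR.
exact: measurable_funD.
Qed.

Lemma mulr_powRD_le (e a t : R) : 0 <= e -> 0 <= t ->
  t * (t + e) `^ (a - 1) <= (t + e) `^ a.
Proof.
move=> e0; rewrite le_eqVlt => /predU1P[<-|t0]; first by rewrite mul0r powR_ge0.
have te : 0 < t + e by lra.
suff -> : (t + e) `^ a = (t + e) * (t + e) `^ (a - 1) by rewrite ler_wpM2r ?powR_ge0// lerDl.
rewrite -[X in X * _](powRr1 (ltW te)) -powRD; first by rewrite (addrC 1) subrK.
by rewrite (gt_eqF te) implybT.
Qed.

Lemma measurable_powR_sqnormD (e a : R) (D : set 'rV[R]_n.+2) :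
  measurable_fun D (fun x => (sqnorm x + e) `^ a).
Proof.
by apply: (measurable_comp_sqnorm (h := fun t => (t + e) `^ a)); exact: measurable_powRD.
Qed.

Lemma measurable_powR_sqnorm (a : R) (D : set 'rV[R]_n.+2) :
  measurable_fun D (fun x => sqnorm x `^ a).
Proof.
by apply: (measurable_comp_sqnorm (h := fun t => t `^ a)); exact: measurable_powR.
Qed.

Lemma ball_integrable_dpowRD (e a : R) : 0 <= e ->
  @ball_integrable R n (fun x => (sqnorm x + e) `^ a) ->
  @ball_integrable R n (fun x => sqnorm x * (a * (sqnorm x + e) `^ (a - 1))).
Proof.
move=> e0 ia; apply: (@ball_integrable_le _ _ _ (fun x => `|a| * (sqnorm x + e) `^ a)).
- apply: measurable_funM; first exact: measurable_sqnorm.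
  by apply: measurable_funM => //; exact: measurable_powR_sqnormD.
- move=> x _; rewrite mulrCA normrM ler_wpM2l// ger0_norm ?mulr_ge0 ?sqnorm_ge0 ?powR_ge0//.
  by rewrite mulr_powRD_le ?sqnorm_ge0.
- exact: ball_integrableZ.
Qed.

(** [integral_radial_div] for h(t) = (t + e)^a - (1 + e)^a, where the constant makes h(1) = 0. It is
    used with [e] positive for a bound and with [e] equal to 0 for exact values. *)
Lemma integral_powRD_id (e a : R) : 0 <= e ->
  @ball_integrable R n (fun x => (sqnorm x + e) `^ a) ->
  (\int[mu]_(x in B) (N * ((sqnorm x + e) `^ a - (1 + e) `^ a) +
    2 * (sqnorm x * (a * (sqnorm x + e) `^ (a - 1))))%:E = 0)%E.
Proof.
move=> e0 ia.
apply: (integral_radial_div (h := fun t : R => (t + e) `^ a - (1 + e) `^ a)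
  (dh := fun t => a * (t + e) `^ (a - 1))).
- move=> t t0; rewrite -[X in is_derive _ _ _ X]subr0.
  by apply: is_deriveB; exact: is_derive_powRD.
- by move=> t t0; apply: contM; [exact: cont_cst|exact: continuous_powRD].
- by rewrite subrr.
- by apply: measurable_funB => //; exact: measurable_powRD.
- by apply: measurable_funM => //; exact: measurable_powRD.
- by apply: ball_integrableD => //; exact: ball_integrable_cst.
- exact: ball_integrable_dpowRD.
Qed.

Lemma ball_integrable_powRD (e a : R) : 0 < e -> a <= 0 ->
  @ball_integrable R n (fun x => (sqnorm x + e) `^ a).
Proof.
move=> e0 a0; apply: (@ball_integrable_bounded _ _ (e `^ a)).
  exact: measurable_powR_sqnormD.
move=> x _; rewrite ger0_norm ?powR_ge0//.
rewrite -[a]opprK !(powRN _ (- a)) lef_pV2 ?posrE ?powR_gt0//; last first.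
  by have := sqnorm_ge0 x; lra.
rewrite ge0_ler_powR ?nnegrE//; have := sqnorm_ge0 x; lra.
Qed.

(** The bound does not depend on [e]. As [a <= 0], [mulr_powRD_le] reverses to a |x|^2 (|x|^2 +
    e)^(a-1) >= a (|x|^2 + e)^a, and (1 + e)^a <= 1, so [integral_powRD_id] bounds (N + 2 a) times
    the integral by N times the volume. *)
Lemma Rintegral_powRD_le (e a : R) : 0 < e -> a <= 0 -> 0 < N + 2 * a ->
  \int[mu]_(x in B) ((sqnorm x + e) `^ a) <= N * @vol R n / (N + 2 * a).
Proof.
move=> e0 a0 Na; have ia := ball_integrable_powRD e0 a0.
have I0 := integral_powRD_id (ltW e0) ia.
rewrite ler_pdivlMr// mulrC -RintegralZl//.
have E : \int[mu]_(x in B) N = N * vol := Rintegral_cst mu measurable_unit_ball N.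
rewrite -E.
rewrite -subr_le0 -RintegralB//; last 2 first.
- exact: ball_integrableZ.
- exact: ball_integrable_cst.
have -> : 0 = fine (\int[mu]_(x in B) (N * ((sqnorm x + e) `^ a - (1 + e) `^ a) +
    2 * (sqnorm x * (a * (sqnorm x + e) `^ (a - 1))))%:E)%E by rewrite I0.
apply: le_Rintegral => //.
- apply: ball_integrable_eq (ball_integrableD (ball_integrableZ (N + 2 * a) ia)
    (ball_integrable_cst (- N))).
  by move=> x _.
- apply: ball_integrableD; last first.
    by apply: ball_integrableZ; exact: ball_integrable_dpowRD (ltW e0) ia.
  by apply: ball_integrableZ; apply: ball_integrableD => //; exact: ball_integrable_cst.
- move=> x _; have /= := mulr_powRD_le a (ltW e0) (sqnorm_ge0 x).
  have e1 : (1 + e) `^ a <= 1.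
    by rewrite -[leRHS](powRr0 (1 + e)) ler_powR// lerDl ltW.
  rewrite (mulrCA (sqnorm x) a); set P := (sqnorm x + e) `^ a; set Q := sqnorm x * _ => QP.
  have : a * P <= a * Q by rewrite ler_wnM2l.
  have : 0 <= N * (1 - (1 + e) `^ a) by rewrite mulr_ge0// subr_ge0.
  lra.
Qed.

(** For [0 <= a] the function is bounded. For negative [a], Fatou's lemma along e = 1/(k+1) passes
    the uniform bound of [Rintegral_powRD_le] to the limit. *)
Lemma ball_integrable_powR (a : R) : 0 < N + 2 * a ->
  @ball_integrable R n (fun x => sqnorm x `^ a).
Proof.
move=> Na; have [a0|a0] := leP 0 a.
  apply: (@ball_integrable_bounded _ _ 1).
    exact: measurable_powR_sqnorm.
  rewrite unit_ballE => x /= x1; rewrite ger0_norm ?powR_ge0//.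
  have := @ge0_ler_powR R a a0 (sqnorm x) 1; rewrite powR1; apply; rewrite ?nnegrE ?sqnorm_ge0//.
  exact: ltW.
have a0' := ltW a0.
have m0 := @measurable_rV_origin R n.+2.
(* The origin is removed because the approximations tend to infinity there, while 0 to a negative
   power is 0 by convention. *)
pose U := B `\` [set (0 : 'rV[R]_n.+2)].
have mU : measurable U by exact: measurableD.
pose F k (x : 'rV[R]_n.+2) := ((sqnorm x + k.+1%:R^-1) `^ a)%:E.
have k0 k : 0 < k.+1%:R^-1 :> R by rewrite invr_gt0.
have FoE x : U x -> limn_einf (F ^~ x) = (sqnorm x `^ a)%:E.
  move=> -[_ /= /eqP x0]; rewrite -sqnorm_gt0 in x0.
  suff /cvg_limn_einf_sup[-> //] : F ^~ x @ \oo --> (sqnorm x `^ a)%:E.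
  apply: cvg_EFin; first by near=> k.
  have c := @continuous_powRD 0 a _ (lexx 0) x0.
  have hx : (fun k => sqnorm x + k.+1%:R^-1) @ \oo --> sqnorm x.
    rewrite -[X in _ --> X]addr0; apply: cvgD; first exact: cvg_cst.
    exact: cvg_harmonic.
  rewrite (_ : fine \o _ = (fun t : R => (t + 0) `^ a) \o (fun k => sqnorm x + k.+1%:R^-1)).
    by rewrite -[X in X `^ a]addr0; apply: continuous_cvg.
  by apply/funext => k /=; rewrite addr0.
have mP (D : set 'rV[R]_n.+2) : measurable_fun D (EFin \o (fun x => sqnorm x `^ a)).
  by apply/measurable_EFinP; exact: measurable_powR_sqnorm.
have fF : (\int[mu]_(x in U) limn_einf (F ^~ x) < +oo)%E.
  apply: le_lt_trans (fatou _ _ _ _) _ => //.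
  - by move=> k; apply/measurable_EFinP; exact: measurable_powR_sqnormD.
  - by move=> k x _; rewrite lee_fin powR_ge0.
  rewrite limn_einf_lim.
  apply: (@le_lt_trans _ _ (N * @vol R n / (N + 2 * a))%:E); last exact: ltry.
  apply: lime_le; first exact: is_cvg_einfs.
  near=> k.
  apply: (@le_trans _ _ (\int[mu]_(x in U) F k x)%E).
    by apply: ereal_inf_lbound; exists k => /=.
  rewrite -ge0_negligible_integral//; last 3 first.
  - by apply/measurable_EFinP; exact: measurable_powR_sqnormD.
  - by move=> x _; rewrite lee_fin powR_ge0.
  - exact: lebesgue_rV_origin.
  rewrite -[X in (X <= _)%E]fineK.
    by rewrite lee_fin; exact: Rintegral_powRD_le.
  apply: integrable_fin_num => //; exact: ball_integrable_powRD.
rewrite /ball_integrable; apply/integrableP; split; first exact: mP.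
rewrite (@ge0_negligible_integral _ _ _ mu B [set 0])//; last 2 first.
- exact: measurableT_comp.
- exact: lebesgue_rV_origin.
move: fF; congr (is_true (_ < _)%E); apply: eq_integral => x.
by rewrite inE => Ux; rewrite FoE//= ger0_norm ?powR_ge0.
Unshelve. all: by end_near.
Qed.

(** At e = 0 the two terms of [integral_powRD_id] involve the same power of |x|, since |x|^2 times
    the power a - 1 of |x|^2 is its power a; so the identity can be solved for the integral. *)
Lemma Rintegral_powR (a : R) : 0 < N + 2 * a ->
  \int[mu]_(x in B) (sqnorm x `^ a) = N * @vol R n / (N + 2 * a).
Proof.
move=> Na; have ia := ball_integrable_powR Na.
have ia' : @ball_integrable R n (fun x => (sqnorm x + 0) `^ a).
  by apply: ball_integrable_eq ia => x _; rewrite addr0.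
have I0 := integral_powRD_id (lexx 0) ia'.
have E : \int[mu]_(x in B) ((N + 2 * a) * sqnorm x `^ a - N) = 0.
  rewrite /Rintegral -[RHS]/(fine 0) -I0; congr fine.
  apply: eq_integral => x _; congr EFin; rewrite !addr0 powR1.
  suff -> : sqnorm x * (a * sqnorm x `^ (a - 1)) = a * sqnorm x `^ a by ring.
  have [x0|x0] := eqVneq (sqnorm x) 0.
    rewrite x0 mul0r; have [->|a0] := eqVneq a 0; first by rewrite mul0r.
    by rewrite powR0// mulr0.
  rewrite mulrCA -{1}(powRr1 (sqnorm_ge0 x)) -powRD ?x0 ?implybT//.
  by rewrite (addrC 1) subrK.
rewrite RintegralB// in E; last 2 first.
- exact: ball_integrableZ.
- exact: ball_integrable_cst.
rewrite RintegralZl// (Rintegral_cst mu mB N) in E.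
apply: (mulfI (lt0r_neq0 Na)); rewrite mulrCA divff ?lt0r_neq0// mulr1 -/vol.
by apply/eqP; rewrite -subr_eq0 E.
Qed.

End power_integrals.

(** * The competitors *)

Section inverse_sqrt.
Context {R : realType}.
Implicit Types z : R.

(** The inverse square root, written as a power so that its derivative comes from
    [is_derive_powRD]. *)
Definition isq z : R := z `^ (- 2^-1).

Lemma isq_ge0 z : 0 <= isq z. Proof. exact: powR_ge0. Qed.

Lemma isq1 : isq 1 = 1. Proof. by rewrite /isq powR1. Qed.

Lemma sqr_isq z : 0 <= z -> isq z ^+ 2 = z^-1.
Proof.
move=> z0; rewrite -powR_mulrn ?isq_ge0// /isq -powRrM.
by rewrite (_ : _ * _ = -1) ?powR_inv1//; field.
Qed.

Lemma is_derive_isq z : 0 < z -> is_derive z 1 isq (- (isq z ^+ 3 / 2)).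
Proof.
move=> z0; have := is_derive_powRD (- 2^-1) (lexx 0) z0.
rewrite addr0 => H.
have -> : - (isq z ^+ 3 / 2) = - 2^-1 * z `^ (- 2^-1 - 1).
  rewrite (_ : - 2^-1 - 1 = - 2^-1 * 3%:R); last by field.
  by rewrite powRrM powR_mulrn ?powR_ge0// -/(isq z); field.
by rewrite (_ : isq = (fun t => (t + 0) `^ (- 2^-1)))//; apply/funext => t; rewrite addr0.
Qed.

Lemma continuous_isq z : 0 < z -> {for z, continuous isq}.
Proof.
move=> z0; apply/differentiable_continuous/derivable1_diffP.
by have [] := is_derive_isq z0.
Qed.

Lemma isq_le1 z : 1 <= z -> isq z <= 1.
Proof.
move=> z1; rewrite -(@expr_le1 _ 2)// ?isq_ge0// sqr_isq ?(le_trans _ z1)//.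
by rewrite invf_le1// (lt_le_trans _ z1).
Qed.

Lemma le_isq : {in Num.pos &, {homo isq : y z /~ y <= z}}.
Proof.
move=> y z; rewrite !posrE => y0 z0 yz.
rewrite -(@ler_pXn2r _ 2)// ?nnegrE ?isq_ge0// (sqr_isq (ltW y0)) (sqr_isq (ltW z0)).
by rewrite lef_pV2.
Qed.

End inverse_sqrt.

Section competitor.
Context {R : realType} {n : nat}.
Variables (k : 'I_n) (s : R).
Implicit Types (e : R) (x : 'rV[R]_n) (i j : 'I_n).

(* u_(k,s) with |x| replaced by sqrt(|x|^2 + e), so smooth for e > 0: cw is
   1/sqrt(|x|^2 + e), cy the regularisation of x/|x|, cv that of
   u0 + s f (e_k - c u0), cM is |cv|^2 at e = 0, and a prefix d marks the partial
   derivatives. *)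
Definition cw e x := isq (sqnorm x + e).
Definition cy e i x := x ord0 i * cw e x.
Definition dcy e i j x := cw e x * ((i == j)%:R - cy e i x * cy e j x).
Definition cf x := (1 - sqnorm x) ^+ 2.
Definition dcf j x := - 4 * (1 - sqnorm x) * x ord0 j.
Definition cv e i x := cy e i x + s * (cf x * ((i == k)%:R - cy e k x * cy e i x)).
Definition dcv e i j x := dcy e i j x +
  s * (dcf j x * ((i == k)%:R - cy e k x * cy e i x) -
       cf x * (dcy e k j x * cy e i x + cy e k x * dcy e i j x)).
Definition cM e x := 1 + s ^+ 2 * (cf x ^+ 2 * (1 - cy e k x ^+ 2)).
Definition dcM e j x := s ^+ 2 *
  (2 * cf x * dcf j x * (1 - cy e k x ^+ 2) - cf x ^+ 2 * (2 * cy e k x * dcy e k j x)).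
Definition cu e i x := cv e i x * isq (cM e x).
Definition dcu e i j x :=
  dcv e i j x * isq (cM e x) - cv e i x * (isq (cM e x) ^+ 3 / 2 * dcM e j x).

Lemma sqr_cw e x : 0 <= e -> cw e x ^+ 2 = (sqnorm x + e)^-1.
Proof. by move=> e0; rewrite sqr_isq// addr_ge0// sqnorm_ge0. Qed.

Lemma cy_sqr_le1 e i x : 0 <= e -> cy e i x ^+ 2 <= 1.
Proof.
move=> e0; rewrite exprMn sqr_cw//.
have := sqnorm_ge0 x; rewrite le_eqVlt => /predU1P[x0|x0].
  have := le_sqr_sqnorm x i; rewrite -x0 => x2.
  by rewrite (_ : x ord0 i ^+ 2 = 0) ?mul0r//; apply/le_anti; rewrite x2 sqr_ge0.
rewrite ler_pdivrMr ?mul1r; last by lra.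
by rewrite (le_trans (le_sqr_sqnorm _ _))// lerDl.
Qed.

(** At e = 0 the perturbation is tangential, so it can only lengthen the unit vector u0. For e > 0
    [cM] is no longer the squared length of [cv], but it still stays above 1, so that dividing by
    its square root is smooth and never enlarges, without any smallness of [s]. *)
Lemma cM_ge1 e x : 0 <= e -> 1 <= cM e x.
Proof.
move=> e0; rewrite lerDl mulr_ge0 ?sqr_ge0// mulr_ge0 ?sqr_ge0//.
by rewrite subr_ge0 cy_sqr_le1.
Qed.

Section gradients.
Variables (e : R) (x : 'rV[R]_n).
Hypotheses (e0 : 0 <= e) (xe0 : 0 < sqnorm x + e).

Lemma has_grad_cw : has_grad (cw e) x (fun j => - (cw e x ^+ 3) * x ord0 j).
Proof.
have := has_grad_comp (is_derive_isq xe0) (has_gradD (has_grad_sqnorm x) (has_grad_cst e x)).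
by move/has_grad_eq; apply => j; rewrite /= /cw addr0; field.
Qed.

Lemma has_grad_cy i : has_grad (cy e i) x (dcy e i ^~ x).
Proof.
have := has_gradM (has_grad_coord i x) has_grad_cw.
move/has_grad_eq; apply => j; rewrite /dcy /cy; ring.
Qed.

Lemma has_grad_cf : has_grad cf x (dcf ^~ x).
Proof.
have := has_gradX 2 (has_gradB (has_grad_cst 1 x) (has_grad_sqnorm x)).
move/has_grad_eq; apply => j; rewrite /dcf /=; ring.
Qed.

Lemma has_grad_cv i : has_grad (cv e i) x (dcv e i ^~ x).
Proof.
have yy := has_gradB (has_grad_cst (i == k)%:R x) (has_gradM (has_grad_cy k) (has_grad_cy i)).
have := has_gradD (has_grad_cy i) (has_gradM (has_grad_cst s x) (has_gradM has_grad_cf yy)).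
move/has_grad_eq; apply => j; rewrite /dcv /=; ring.
Qed.

Lemma has_grad_cM : has_grad (cM e) x (dcM e ^~ x).
Proof.
have yy := has_gradB (has_grad_cst 1 x) (has_gradX 2 (has_grad_cy k)).
have := has_gradD (has_grad_cst 1 x)
  (has_gradM (has_grad_cst (s ^+ 2) x) (has_gradM (has_gradX 2 has_grad_cf) yy)).
move/has_grad_eq; apply => j; rewrite /dcM /=; ring.
Qed.

(** The hypothesis on [sqnorm x + e] covers both uses: e = 0 away from the origin, for the weak
    gradient, and e > 0 everywhere, for the C^1 approximations in the trace. *)
Lemma has_grad_cu i : has_grad (cu e i) x (dcu e i ^~ x).
Proof.
have M0 : 0 < cM e x by apply: lt_le_trans (cM_ge1 x e0).
have := has_gradM (has_grad_cv i) (has_grad_comp (is_derive_isq M0) has_grad_cM).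
move/has_grad_eq; apply => j; rewrite /dcu /=; ring.
Qed.

End gradients.

End competitor.

(** * Joint continuity in the point and in the regularisation parameter *)

Section competitor_continuity.
Context {R : realType} {n : nat} {T : topologicalType}.
Variables (k : 'I_n) (s : R) (X : T -> 'rV[R]_n) (E : T -> R) (t : T).
Hypothesis cX : forall i, {for t, continuous (fun t => X t ord0 i)}.
Hypothesis cE : {for t, continuous E}.
Hypotheses (E0 : 0 <= E t) (XE0 : 0 < sqnorm (X t) + E t).

Lemma cont_sum (m : nat) (F : 'I_m -> T -> R) : (forall i, {for t, continuous (F i)}) ->
  {for t, continuous (fun t => \sum_i F i t)}.
Proof.
elim: m F => [|m IH] F cF.
  rewrite (_ : (fun t => _) = (fun=> 0)); first exact: cont_cst.
  by apply/funext => u; rewrite big_ord0.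
rewrite (_ : (fun t => _) = (fun t => F ord0 t + \sum_i F (lift ord0 i) t)).
  by apply: contD => //; exact: IH.
by apply/funext => u; rewrite big_ord_recl.
Qed.

Lemma cont_sqnorm : {for t, continuous (fun t => sqnorm (X t))}.
Proof. by apply: cont_sum => i; exact: contX. Qed.

Lemma cont_cw : {for t, continuous (fun t => cw (E t) (X t))}.
Proof.
apply: cont_comp; first exact: continuous_isq.
by apply: contD => //; exact: cont_sqnorm.
Qed.

Lemma cont_cy i : {for t, continuous (fun t => cy (E t) i (X t))}.
Proof. by apply: contM => //; exact: cont_cw. Qed.

Lemma cont_dcy i j : {for t, continuous (fun t => dcy (E t) i j (X t))}.
Proof.
apply: contM; first exact: cont_cw.
by apply: contB; [exact: cont_cst|apply: contM; exact: cont_cy].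
Qed.

Lemma cont_cf : {for t, continuous (fun t => cf (X t))}.
Proof. by apply: contX; apply: contB; [exact: cont_cst|exact: cont_sqnorm]. Qed.

Lemma cont_dcf j : {for t, continuous (fun t => dcf j (X t))}.
Proof.
apply: contM => //; apply: contM; first exact: cont_cst.
by apply: contB; [exact: cont_cst|exact: cont_sqnorm].
Qed.

Lemma cont_proj i :
  {for t, continuous (fun t => (i == k)%:R - cy (E t) k (X t) * cy (E t) i (X t))}.
Proof. by apply: contB; [exact: cont_cst|apply: contM; exact: cont_cy]. Qed.

Lemma cont_cv i : {for t, continuous (fun t => cv k s (E t) i (X t))}.
Proof.
apply: contD; first exact: cont_cy.
by apply: contM; [exact: cont_cst|apply: contM; [exact: cont_cf|exact: cont_proj]].
Qed.

Lemma cont_dcv i j : {for t, continuous (fun t => dcv k s (E t) i j (X t))}.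
Proof.
apply: contD; first exact: cont_dcy.
apply: contM; first exact: cont_cst.
apply: contB; first by apply: contM; [exact: cont_dcf|exact: cont_proj].
apply: contM; first exact: cont_cf.
by apply: contD; apply: contM; (exact: cont_cy || exact: cont_dcy).
Qed.

Lemma cont_cM : {for t, continuous (fun t => cM k s (E t) (X t))}.
Proof.
apply: contD; first exact: cont_cst.
apply: contM; first exact: cont_cst.
apply: contM; first by apply: contX; exact: cont_cf.
by apply: contB; [exact: cont_cst|apply: contX; exact: cont_cy].
Qed.

Lemma cont_dcM j : {for t, continuous (fun t => dcM k s (E t) j (X t))}.
Proof.
apply: contM; first exact: cont_cst.
apply: contB; apply: contM.
- apply: contM; last exact: cont_dcf.
  by apply: contM; [exact: cont_cst|exact: cont_cf].
- by apply: contB; [exact: cont_cst|apply: contX; exact: cont_cy].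
- by apply: contX; exact: cont_cf.
- apply: contM; last exact: cont_dcy.
  by apply: contM; [exact: cont_cst|exact: cont_cy].
Qed.

Lemma cont_isq_cM : {for t, continuous (fun t => isq (cM k s (E t) (X t)))}.
Proof.
apply: cont_comp; last exact: cont_cM.
by apply: continuous_isq; apply: lt_le_trans (cM_ge1 _ _ _ E0).
Qed.

Lemma cont_cu i : {for t, continuous (fun t => cu k s (E t) i (X t))}.
Proof. by apply: contM; [exact: cont_cv|exact: cont_isq_cM]. Qed.

(** Since both [X] and [E] depend on [t], this gives continuity in x ([X] the identity, [E]
    constant) and also convergence as e tends to 0 ([X] constant, [E] the identity). *)
Lemma cont_dcu i j : {for t, continuous (fun t => dcu k s (E t) i j (X t))}.
Proof.
apply: contB; first by apply: contM; [exact: cont_dcv|exact: cont_isq_cM].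
apply: contM; first exact: cont_cv.
apply: contM; last exact: cont_dcM.
by apply: contM; [apply: contX; exact: cont_isq_cM|exact: cont_cst].
Qed.

End competitor_continuity.

Section competitor_measurability.
Context {R : realType} {n : nat}.
Variables (k : 'I_n) (s e : R) (D : set 'rV[R]_n).

Lemma measurable_isq (g : 'rV[R]_n -> R) :
  measurable_fun D g -> measurable_fun D (fun x => isq (g x)).
Proof.
move=> mg; apply: (measurableT_comp (f := @isq R)) => //; exact: measurable_powR.
Qed.

Lemma measurable_cy i : measurable_fun D (cy e i).
Proof.
apply: measurable_funM; first exact: measurable_coord.
by apply: measurable_isq; apply: measurable_funD => //; exact: measurable_sqnorm.
Qed.

Lemma measurable_dcy i j : measurable_fun D (dcy e i j).
Proof.
apply: measurable_funM.
  by apply: measurable_isq; apply: measurable_funD => //; exact: measurable_sqnorm.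
by apply: measurable_funB => //; apply: measurable_funM; exact: measurable_cy.
Qed.

Lemma measurable_cf : measurable_fun D cf.
Proof. by apply: measurable_funX; apply: measurable_funB => //; exact: measurable_sqnorm. Qed.

Lemma measurable_dcf j : measurable_fun D (dcf j).
Proof.
apply: measurable_funM; last exact: measurable_coord.
by apply: measurable_funM => //; apply: measurable_funB => //; exact: measurable_sqnorm.
Qed.

Lemma measurable_proj i : measurable_fun D (fun x => (i == k)%:R - cy e k x * cy e i x).
Proof. by apply: measurable_funB => //; apply: measurable_funM; exact: measurable_cy. Qed.

Lemma measurable_cv i : measurable_fun D (cv k s e i).
Proof.
apply: measurable_funD; first exact: measurable_cy.
apply: measurable_funM => //; apply: measurable_funM; [exact: measurable_cf|exact: measurable_proj].
Qed.

Lemma measurable_dcv i j : measurable_fun D (dcv k s e i j).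
Proof.
apply: measurable_funD; first exact: measurable_dcy.
apply: measurable_funM => //; apply: measurable_funB.
  by apply: measurable_funM; [exact: measurable_dcf|exact: measurable_proj].
apply: measurable_funM; first exact: measurable_cf.
by apply: measurable_funD; apply: measurable_funM; (exact: measurable_cy || exact: measurable_dcy).
Qed.

Lemma measurable_cM : measurable_fun D (cM k s e).
Proof.
apply: measurable_funD => //; apply: measurable_funM => //; apply: measurable_funM.
  by apply: measurable_funX; exact: measurable_cf.
by apply: measurable_funB => //; apply: measurable_funX; exact: measurable_cy.
Qed.

Lemma measurable_dcM j : measurable_fun D (dcM k s e j).
Proof.
apply: measurable_funM => //; apply: measurable_funB; apply: measurable_funM.
- apply: measurable_funM; last exact: measurable_dcf.
  by apply: measurable_funM => //; exact: measurable_cf.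
- by apply: measurable_funB => //; apply: measurable_funX; exact: measurable_cy.
- by apply: measurable_funX; exact: measurable_cf.
- apply: measurable_funM; last exact: measurable_dcy.
  by apply: measurable_funM => //; exact: measurable_cy.
Qed.

Lemma measurable_cu i : measurable_fun D (cu k s e i).
Proof.
apply: measurable_funM; first exact: measurable_cv.
by apply: measurable_isq; exact: measurable_cM.
Qed.

Lemma measurable_dcu i j : measurable_fun D (dcu k s e i j).
Proof.
have mi : measurable_fun D (fun x => isq (cM k s e x)).
  by apply: measurable_isq; exact: measurable_cM.
apply: measurable_funB; first by apply: measurable_funM => //; exact: measurable_dcv.
apply: measurable_funM; first exact: measurable_cv.
apply: measurable_funM; last exact: measurable_dcM.
by apply: measurable_funM => //; exact: measurable_funX.
Qed.

End competitor_measurability.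

Section competitor_bounds.
Context {R : realType} {n : nat}.
Variables (k : 'I_n) (s e : R) (x : 'rV[R]_n).
Hypotheses (s1 : `|s| <= 1) (e0 : 0 <= e) (x1 : sqnorm x <= 1).

Lemma normD_le (a b c d : R) : `|a| <= c -> `|b| <= d -> `|a + b| <= c + d.
Proof. by move=> ac bd; apply: le_trans (ler_normD _ _) _; exact: lerD. Qed.

Lemma normB_le (a b c d : R) : `|a| <= c -> `|b| <= d -> `|a - b| <= c + d.
Proof. by move=> ac bd; apply: le_trans (ler_normB _ _) _; exact: lerD. Qed.

Lemma normM_le (a b c d : R) : `|a| <= c -> `|b| <= d -> `|a * b| <= c * d.
Proof. by move=> ac bd; rewrite normrM ler_pM. Qed.

Lemma norm_le1_sqr (a : R) : a ^+ 2 <= 1 -> `|a| <= 1.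
Proof. by move=> a1; rewrite -(@expr_le1 _ 2)// real_normK// num_real. Qed.

Lemma cy_le1 i : `|cy e i x| <= 1.
Proof. by apply: norm_le1_sqr; exact: cy_sqr_le1. Qed.

Lemma coord_le1 i : `|x ord0 i| <= 1.
Proof. by apply: norm_le1_sqr; rewrite (le_trans (le_sqr_sqnorm _ _)). Qed.

Lemma cf_le1 : `|cf x| <= 1.
Proof.
rewrite /cf ger0_norm ?sqr_ge0// expr_le1// ?subr_ge0// lerBlDr lerDl.
exact: sqnorm_ge0.
Qed.

Lemma dcf_le4 j : `|dcf j x| <= 4.
Proof.
rewrite -[leRHS]mulr1; apply: normM_le; last exact: coord_le1.
rewrite -[leRHS]mulr1; apply: normM_le; first by rewrite normrN ger0_norm.
by rewrite ger0_norm ?subr_ge0// lerBlDr lerDl sqnorm_ge0.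
Qed.

Lemma nat_eq_le1 (b : bool) : `|b%:R : R| <= 1.
Proof. by case: b; rewrite ?normr1 ?normr0. Qed.

Lemma proj_le2 i j (b : bool) : `|b%:R - cy e i x * cy e j x| <= 1 + 1.
Proof.
apply: normB_le; first exact: nat_eq_le1.
by rewrite -[leRHS]mulr1; apply: normM_le; exact: cy_le1.
Qed.

Lemma cv_le3 i : `|cv k s e i x| <= 3.
Proof.
have := normD_le (cy_le1 i) (normM_le s1 (normM_le cf_le1 (proj_le2 k i (i == k)))).
by move/le_trans; apply; lra.
Qed.

Lemma isq_cM_le1 : `|isq (cM k s e x)| <= 1.
Proof. by rewrite ger0_norm ?isq_ge0// isq_le1// cM_ge1. Qed.

Lemma cu_le3 i : `|cu k s e i x| <= 3.
Proof. by rewrite -[leRHS]mulr1; apply: normM_le; [exact: cv_le3|exact: isq_cM_le1]. Qed.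

Hypothesis x0 : x != 0.
Let r := isq (sqnorm x).

Lemma cw_le : `|cw e x| <= r.
Proof.
have sx : 0 < sqnorm x by rewrite sqnorm_gt0.
by rewrite ger0_norm ?isq_ge0// le_isq ?posrE// ?lerDl// ltr_wpDr.
Qed.

Lemma isq_sqnorm_ge1 : 1 <= r.
Proof. by rewrite -[leLHS](@isq1 R) le_isq ?posrE ?sqnorm_gt0. Qed.

Lemma dcy_le i j : `|dcy e i j x| <= r * (1 + 1).
Proof. by apply: normM_le; [exact: cw_le|exact: proj_le2]. Qed.

(** What matters is a multiple of 1/|x| that is uniform in [e] and [s], to dominate the limits.
    Bounded terms are absorbed by [1 <= r], and 32 = 14 + 3 (12 / 2) collects the bounds on [dcv],
    [cv] and [dcM]. *)
Lemma dcu_le i j : `|dcu k s e i j x| <= 32 * r.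
Proof.
have r1 := isq_sqnorm_ge1.
have dv : `|dcv k s e i j x| <= 14 * r.
  have A := normM_le (dcf_le4 j) (proj_le2 k i (i == k)).
  have C := normD_le (normM_le (dcy_le k j) (cy_le1 i)) (normM_le (cy_le1 k) (dcy_le i j)).
  have := normD_le (dcy_le i j) (normM_le s1 (normB_le A (normM_le cf_le1 C))).
  by move/le_trans; apply; lra.
have s21 : `|s ^+ 2| <= 1 by rewrite expr2 -[leRHS]mulr1; exact: normM_le.
have f21 : `|cf x ^+ 2| <= 1.
  by rewrite expr2 -[leRHS]mulr1; apply: normM_le; exact: cf_le1.
have n2 : `|2 : R| <= 2 by rewrite ger0_norm.
have dm : `|dcM k s e j x| <= 12 * r.
  have A' : `|2 * cf x * dcf j x * (1 - cy e k x ^+ 2)| <= 8.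
    apply: (le_trans (normM_le (normM_le (normM_le n2 cf_le1) (dcf_le4 j)) (_ : _ <= 1)));
      last by lra.
    by rewrite ger0_norm ?subr_ge0 ?cy_sqr_le1// lerBlDr lerDl sqr_ge0.
  have C := normM_le f21 (normM_le (normM_le n2 (cy_le1 k)) (dcy_le k j)).
  have := normM_le s21 (normB_le A' C).
  by move/le_trans; apply; lra.
have m3 : `|isq (cM k s e x) ^+ 3 / 2| <= 2^-1.
  rewrite -[leRHS]mul1r; apply: normM_le; last by rewrite ger0_norm.
  by rewrite normrX expr_le1// isq_cM_le1.
have := normB_le (normM_le dv isq_cM_le1) (normM_le (cv_le3 i) (normM_le m3 dm)).
by move/le_trans; apply; lra.
Qed.

End competitor_bounds.

(** * Energy densities *)

Section tangent_projection.
Context {R : realType} {n : nat}.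
Variables (y : 'I_n -> R).
Hypothesis y1 : \sum_i y i ^+ 2 = 1.
Local Notation N := (n%:R : R).

(** The matrix of the orthogonal projection onto the hyperplane orthogonal to the unit vector [y].
    Below, [sum_tproj_tproj] is its idempotence and [sum_tproj_diag] its trace. *)
Definition tproj i j : R := (i == j)%:R - y i * y j.
Local Notation P := tproj.

Lemma tprojC i j : P i j = P j i.
Proof. by rewrite /tproj eq_sym mulrC. Qed.

Lemma sum_delta (g : 'I_n -> R) j : \sum_i (i == j)%:R * g i = g j.
Proof.
rewrite (bigD1 j)//= eqxx mul1r big1 ?addr0// => i /negbTE ->.
by rewrite mul0r.
Qed.

Lemma sum_tproj (g : 'I_n -> R) j : \sum_i P i j * g i = g j - y j * \sum_i y i * g i.
Proof.
under eq_bigr do rewrite /tproj mulrBl.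
rewrite sumrB sum_delta; congr (_ - _); rewrite mulr_sumr.
by apply: eq_bigr => i _; ring.
Qed.

Lemma sum_yy : \sum_i y i * y i = 1.
Proof. by rewrite -[RHS]y1; apply: eq_bigr => i _; rewrite expr2. Qed.

Lemma sum_tproj_y j : \sum_i P i j * y i = 0.
Proof. by rewrite sum_tproj sum_yy mulr1 subrr. Qed.

Lemma sum_tproj_tproj j l : \sum_i P i j * P i l = P l j.
Proof.
rewrite sum_tproj (_ : \sum_i _ = 0) ?mulr0 ?subr0; first by rewrite tprojC.
by under eq_bigr do rewrite mulrC; exact: sum_tproj_y.
Qed.

Lemma sum_tproj_diag : \sum_j P j j = N - 1.
Proof.
rewrite /tproj sumrB sum_yy; congr (_ - _).
by under eq_bigr do rewrite eqxx; rewrite sumr_const card_ord.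
Qed.

Lemma tproj_diag j : P j j = 1 - y j ^+ 2.
Proof. by rewrite /tproj eqxx expr2. Qed.

(* Squared length of a combination of the two tangent vectors P_j, P_k and the
   normal vector y. *)
Lemma sum_sqr_tproj (A C D : R) j k :
  \sum_i (A * P i j + C * P i k + D * y i) ^+ 2 =
  A ^+ 2 * P j j + C ^+ 2 * P k k + 2 * (A * C) * P k j + D ^+ 2.
Proof.
transitivity (A ^+ 2 * (\sum_i P i j * P i j) + C ^+ 2 * (\sum_i P i k * P i k) +
  2 * (A * C) * (\sum_i P i j * P i k) + D ^+ 2 * (\sum_i y i * y i) +
  2 * (A * D) * (\sum_i P i j * y i) + 2 * (C * D) * (\sum_i P i k * y i)).
  by rewrite !mulr_sumr -!big_split/=; apply: eq_bigr => i _; ring.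
by rewrite !sum_tproj_tproj !sum_tproj_y sum_yy; ring.
Qed.

Variables (k : 'I_n) (w a b m : R).
(** In the application [y] is x/|x|, [w] is 1/|x|, [a] is s f, [b] is the radial derivative s f',
    and [m] is the factor 1/|v|. Then [v] is u0 + s f (e_k - c u0); as w P_ij is the j-th partial
    derivative of y_i, the product rule gives [dv], and [dM] is the derivative of M = |v|^2. *)
Let c := y k.
Let M := 1 + a ^+ 2 * P k k.
Let v i := y i + a * P i k.
Let dv i j := (1 - a * c) * w * P i j + b * y j * P i k - a * w * P k j * y i.
Let dM j := 2 * (a * b * y j * P k k - a ^+ 2 * c * w * P k j).

Lemma sum_sqr_v : \sum_i v i ^+ 2 = M.
Proof.
have := sum_sqr_tproj 0 a 1 k k; rewrite /M.
under eq_bigr do rewrite mul0r add0r mul1r addrC.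
by move=> ->; ring.
Qed.

Lemma sum_v_dv j : \sum_i v i * dv i j = dM j / 2.
Proof.
transitivity ((1 - a * c) * w * (\sum_i P i j * y i) + b * y j * (\sum_i P i k * y i)
  - a * w * P k j * (\sum_i y i * y i) + a * ((1 - a * c) * w) * (\sum_i P i j * P i k)
  + a * b * y j * (\sum_i P i k * P i k) - a * (a * w * P k j) * (\sum_i P i k * y i)).
  by rewrite !mulr_sumr -!(sumrB, big_split)/=; apply: eq_bigr => i _; rewrite /v /dv; ring.
by rewrite !sum_tproj_tproj !sum_tproj_y sum_yy /dM; field.
Qed.

(** For fixed j, the vector (dv i j)_i is a combination as in [sum_sqr_tproj]. Summed over j, the
    mixed term contains P y and vanishes, and the trace of P produces N - 1. *)
Lemma sum_sqr_dv : \sum_i \sum_j dv i j ^+ 2 =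
  (N - 1) * ((1 - a * c) * w) ^+ 2 + (b ^+ 2 + (a * w) ^+ 2) * P k k.
Proof.
rewrite exchange_big/=.
rewrite (eq_bigr (fun j => ((1 - a * c) * w) ^+ 2 * P j j + (b ^+ 2 * P k k) * (y j * y j)
    + 2 * ((1 - a * c) * w * b) * (P j k * y j) + (a * w) ^+ 2 * (P j k * P j k))) => [|j _].
  rewrite !big_split/= -!mulr_sumr sum_tproj_diag sum_yy sum_tproj_y sum_tproj_tproj.
  by ring.
rewrite (_ : \sum_i _ =
  \sum_i ((1 - a * c) * w * P i j + b * y j * P i k + (- (a * w * P k j)) * y i) ^+ 2).
  by rewrite sum_sqr_tproj (tprojC j k); ring.
by apply: eq_bigr => i _; rewrite /dv mulNr.
Qed.

(* Normalising v to the sphere only shortens its derivative. *)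
Lemma sum_sqr_du : m ^+ 2 * M = 1 ->
  \sum_i \sum_j (dv i j * m - v i * (m ^+ 3 / 2 * dM j)) ^+ 2 <=
  m ^+ 2 * ((N - 1) * ((1 - a * c) * w) ^+ 2 + (b ^+ 2 + (a * w) ^+ 2) * P k k).
Proof.
move=> mM; rewrite -sum_sqr_dv mulr_sumr exchange_big/=.
under [leRHS]eq_bigr do rewrite mulr_sumr.
rewrite [leRHS]exchange_big/=; apply: ler_sum => j _.
have -> : \sum_i (dv i j * m - v i * (m ^+ 3 / 2 * dM j)) ^+ 2 =
    m ^+ 2 * (\sum_i dv i j ^+ 2) - m ^+ 4 * dM j * (\sum_i v i * dv i j)
    + m ^+ 6 / 4 * dM j ^+ 2 * (\sum_i v i ^+ 2).
  by rewrite !mulr_sumr -!(sumrB, big_split)/=; apply: eq_bigr => i _; field.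
(* With v . dv = dM/2, |v|^2 = M and m^2 M = 1 the correction is -m^4 dM^2/2 + m^4 dM^2/4, minus a
   square. *)
rewrite sum_v_dv sum_sqr_v -mulr_sumr -addrA gerDl.
rewrite (_ : _ / 4 * _ * M = m ^+ 4 * dM j ^+ 2 / 4 * (m ^+ 2 * M)); last by ring.
rewrite mM (_ : _ + _ = - ((m ^+ 2 * dM j / 2) ^+ 2)); last by field.
by rewrite oppr_le0 sqr_ge0.
Qed.

End tangent_projection.

Section competitor_density.
Context {R : realType} {n : nat}.
Implicit Types (k i j : 'I_n) (s : R).
Local Notation N := (n%:R : R).

Definition cmap k s e (x : 'rV[R]_n) : 'rV[R]_n := \row_i cu k s e i x.
Definition dcmap k s e (x : 'rV[R]_n) : 'M[R]_n := \matrix_(i, j) dcu k s e i j x.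

Lemma sqr_hs_norm (A : 'M[R]_n) : hs_norm A ^+ 2 = \sum_i \sum_j A i j ^+ 2.
Proof.
rewrite sqr_sqrtr; last by do 2!apply: sumr_ge0 => ? _; rewrite exprn_ge0.
by do 2!apply: eq_bigr => ? _; rewrite real_normK// num_real.
Qed.

Variable x : 'rV[R]_n.
Hypothesis x0 : x != 0.
Let q := sqnorm x.
Let q0 : 0 < q. Proof. by rewrite /q sqnorm_gt0. Qed.
Let w := cw 0 x.
Let w2 : w ^+ 2 = q^-1. Proof. by rewrite /w sqr_cw// addr0. Qed.
Let w0 : w != 0. Proof. by rewrite -sqrf_eq0 w2 invr_eq0 gt_eqF. Qed.

Lemma sum_sqr_cy0 : \sum_i cy 0 i x ^+ 2 = 1.
Proof.
rewrite /cy; under eq_bigr do rewrite exprMn.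
by rewrite -mulr_suml -/(sqnorm x) w2 divff// gt_eqF.
Qed.

Let y := cy 0 ^~ x.
Let a s := s * cf x.
Let b s := s * (- 4 * (1 - q) / w).

Let cvE k s i : cv k s 0 i x = y i + a s * tproj y i k.
Proof. by rewrite /cv /tproj /a /y; ring. Qed.

Let coordE j : x ord0 j = y j / w.
Proof. by rewrite /y /cy mulfK. Qed.

Let dcvE k s i j : dcv k s 0 i j x = (1 - a s * y k) * w * tproj y i j
   + b s * y j * tproj y i k - a s * w * tproj y k j * y i.
Proof. by rewrite /dcv /dcy /dcf coordE /tproj /a /b -/w /y -/q; field. Qed.

Let cME k s : cM k s 0 x = 1 + a s ^+ 2 * tproj y k k.
Proof. by rewrite /cM tproj_diag /a /y; ring. Qed.

Let dcME k s j : dcM k s 0 j x =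
  2 * (a s * b s * y j * tproj y k k - a s ^+ 2 * y k * w * tproj y k j).
Proof. by rewrite /dcM /dcy /dcf coordE tproj_diag /a /b -/w /y -/q /tproj; field. Qed.

Let mM k s : isq (cM k s 0 x) ^+ 2 * cM k s 0 x = 1.
Proof.
have M1 := cM_ge1 k s x (lexx 0).
by rewrite sqr_isq ?mulVf ?(le_trans _ M1)// gt_eqF// (lt_le_trans _ M1).
Qed.

Lemma enorm_cmap k s : enorm (cmap k s 0 x) = 1.
Proof.
rewrite /enorm (eq_bigr (fun i => isq (cM k s 0 x) ^+ 2 * (y i + a s * tproj y i k) ^+ 2)) => [|i _].
  rewrite -mulr_sumr (sum_sqr_v sum_sqr_cy0) -/y -cME mM sqrtr1//.
by rewrite mxE /cu cvE exprMn mulrC.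
Qed.

(** This is [sum_sqr_du] with w^2 = 1/q and m^2 = 1/M; the term 16 (1 - q)^2 q is f'^2, the squared
    radial derivative of f. *)
Lemma hs_norm_dcmap k s : hs_norm (dcmap k s 0 x) ^+ 2 <=
  ((N - 1) * (1 - s * cf x * cy 0 k x) ^+ 2 / q +
   s ^+ 2 * (16 * (1 - q) ^+ 2 * q + cf x ^+ 2 / q) * (1 - cy 0 k x ^+ 2)) /
  (1 + s ^+ 2 * cf x ^+ 2 * (1 - cy 0 k x ^+ 2)).
Proof.
rewrite sqr_hs_norm.
under eq_bigr => i _ do under eq_bigr => j _ do rewrite mxE /dcu dcvE cvE dcME.
have mM' : isq (cM k s 0 x) ^+ 2 * (1 + a s ^+ 2 * tproj y k k) = 1.
  by rewrite -cME mM.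
apply: le_trans (sum_sqr_du sum_sqr_cy0 w (b s) mM') _.
have M0 : 1 + a s ^+ 2 * tproj y k k != 0.
  by apply: contra_eq_neq mM' => ->; rewrite mulr0 eq_sym oner_neq0.
have -> : isq (cM k s 0 x) ^+ 2 = (1 + a s ^+ 2 * tproj y k k)^-1.
  by apply: (mulIf M0); rewrite mM' mulVf.
rewrite le_eqVlt; apply/orP; left; apply/eqP.
rewrite [LHS]mulrC -/y tproj_diag -/(y k) /a exprMn; congr (_ / _); last by rewrite exprMn.
rewrite /b !exprMn exprVn w2 invrK; field.
by rewrite gt_eqF.
Qed.

(** An equality, unlike [hs_norm_dcmap]: it computes the energy of u0, against which the competitors
    are measured. *)
Lemma hs_norm_dcmap0 k : hs_norm (dcmap k 0 0 x) ^+ 2 = (N - 1) / q.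
Proof.
rewrite sqr_hs_norm.
transitivity (\sum_i \sum_j
  ((1 - 0 * y k) * w * tproj y i j + 0 * y j * tproj y i k - 0 * w * tproj y k j * y i) ^+ 2).
  apply: eq_bigr => i _; apply: eq_bigr => j _; rewrite mxE /dcu dcvE dcME.
  rewrite (_ : cM _ _ _ _ = 1) ?isq1; last by rewrite cME /a; ring.
  by rewrite /a /b; congr (_ ^+ 2); ring.
by rewrite (sum_sqr_dv sum_sqr_cy0) -w2 -/y; ring.
Qed.

End competitor_density.

Section averaged_density.
Context {R : realType} {n : nat}.
Local Notation N := (n%:R : R).

(* With T = s^2 f^2 (1 - c^2) this is 1/(1+T) <= 1 - T + s^4, up to terms of a
   favourable sign; the sum over the two signs of s removes the terms odd in s. *)
Lemma pair_density_le (s f c g r : R) : `|s| <= 1 -> `|f| <= 1 -> `|c| <= 1 -> 0 <= g -> 0 <= r ->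
  1 <= N ->
  ((N - 1) * (1 - s * f * c) ^+ 2 * r + s ^+ 2 * (g + f ^+ 2 * r) * (1 - c ^+ 2)) /
    (1 + s ^+ 2 * f ^+ 2 * (1 - c ^+ 2)) +
  ((N - 1) * (1 - - s * f * c) ^+ 2 * r + (- s) ^+ 2 * (g + f ^+ 2 * r) * (1 - c ^+ 2)) /
    (1 + (- s) ^+ 2 * f ^+ 2 * (1 - c ^+ 2)) <=
  2 * ((N - 1) * r * (1 + s ^+ 2 * f ^+ 2 * (2 * c ^+ 2 - 1) + s ^+ 4) +
       s ^+ 2 * (g + f ^+ 2 * r) * (1 - c ^+ 2)).
Proof.
move=> s1 f1 c1 g0 r0 N1.
have sqr1 (t : R) : `|t| <= 1 -> t ^+ 2 <= 1.
  by move=> t1; rewrite -real_normK ?num_real// expr_le1.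
have := sqr1 _ s1; have := sqr1 _ f1; have := sqr1 _ c1.
have := sqr_ge0 s; have := sqr_ge0 f; have := sqr_ge0 c.
rewrite sqrrN -mulrDl.
set T := s ^+ 2 * f ^+ 2 * (1 - c ^+ 2).
move=> c20 f20 s20 c21 f21 s21.
have c2 : 0 <= 1 - c ^+ 2 by lra.
have sf0 : 0 <= s ^+ 2 * f ^+ 2 by exact: mulr_ge0.
have T0 : 0 <= T by exact: mulr_ge0.
have Ts : T <= s ^+ 2.
  rewrite /T -mulrA ler_piMr// mulr_ile1//; lra.
rewrite ler_pdivrMr; last by lra.
have H1 : 1 + s ^+ 2 * f ^+ 2 * c ^+ 2 <=
    (1 + s ^+ 2 * f ^+ 2 * (2 * c ^+ 2 - 1) + s ^+ 4) * (1 + T).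
  have -> : s ^+ 2 * f ^+ 2 * (2 * c ^+ 2 - 1) = s ^+ 2 * f ^+ 2 * c ^+ 2 - T by rewrite /T; ring.
  set Q := s ^+ 2 * f ^+ 2 * c ^+ 2.
  have Q0 : 0 <= Q by exact: mulr_ge0.
  have TT : T ^+ 2 <= s ^+ 4 by rewrite (_ : s ^+ 4 = (s ^+ 2) ^+ 2) ?ler_sqr//; ring.
  have QT : 0 <= Q * T by rewrite mulr_ge0.
  have sT : 0 <= s ^+ 4 * T by rewrite mulr_ge0// exprn_even_ge0.
  rewrite (_ : _ * (1 + T) = 1 + Q + (s ^+ 4 - T ^+ 2) + Q * T + s ^+ 4 * T); last by ring.
  lra.
set K := s ^+ 2 * (g + f ^+ 2 * r) * (1 - c ^+ 2).
have K0 : 0 <= K by rewrite /K mulr_ge0// mulr_ge0// addr_ge0// mulr_ge0.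
have KT : 0 <= K * T by rewrite mulr_ge0.
have Nr : 0 <= (N - 1) * r by rewrite mulr_ge0// subr_ge0.
have := ler_wpM2l Nr H1.
rewrite (_ : (N - 1) * (1 - s * f * c) ^+ 2 * r + K + ((N - 1) * (1 - - s * f * c) ^+ 2 * r + K) =
  2 * ((N - 1) * r * (1 + s ^+ 2 * f ^+ 2 * c ^+ 2)) + 2 * K); last by ring.
set L := (N - 1) * r * _; set U := (N - 1) * r * (_ * _) => LU.
rewrite (_ : 2 * _ * (1 + T) = 2 * U + 2 * K + 2 * (K * T)); last by rewrite /U; ring.
lra.
Qed.

(** Origin of N - 3: over k, the terms 2 c_k^2 - 1 add up to 2 - N and the terms 1 - c_k^2 to N - 1,
    so after extraction of the factor N - 1 the coefficient of s^2 f^2 / q is (2 - N) + 1. *)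
Lemma sum_density_le (x : 'rV[R]_n) (s : R) : (0 < n)%N -> x != 0 -> sqnorm x <= 1 -> `|s| <= 1 ->
  \sum_k (hs_norm (dcmap k s 0 x) ^+ 2 + hs_norm (dcmap k (- s) 0 x) ^+ 2) <=
  2 * (N - 1) * (N / sqnorm x +
    s ^+ 2 * (16 * (1 - sqnorm x) ^+ 2 * sqnorm x - (N - 3) * (cf x ^+ 2 / sqnorm x)) +
    N * s ^+ 4 / sqnorm x).
Proof.
move=> n0 x0 x1 s1; set q := sqnorm x.
have q0 : 0 < q by rewrite sqnorm_gt0.
pose F (k : 'I_n) := 2 * ((N - 1) * q^-1 *
         (1 + s ^+ 2 * cf x ^+ 2 * (2 * cy 0 k x ^+ 2 - 1) + s ^+ 4) +
       s ^+ 2 * (16 * (1 - q) ^+ 2 * q + cf x ^+ 2 * q^-1) * (1 - cy 0 k x ^+ 2)).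
apply: (@le_trans _ _ (\sum_k F k)).
  apply: ler_sum => k _.
  apply: le_trans (lerD (hs_norm_dcmap x0 k s) (hs_norm_dcmap x0 k (- s))) _.
  apply: pair_density_le => //; [exact: cf_le1|exact: cy_le1| | |by rewrite ler1n].
    by rewrite mulr_ge0 ?sqnorm_ge0// mulr_ge0 ?sqr_ge0.
  by rewrite invr_ge0 sqnorm_ge0.
have sc := sum_sqr_cy0 x0.
have S : \sum_k F k = 2 * ((N - 1) * q^-1 * (N + s ^+ 2 * cf x ^+ 2 * (2 - N) + N * s ^+ 4) +
    s ^+ 2 * (16 * (1 - q) ^+ 2 * q + cf x ^+ 2 * q^-1) * (N - 1)).
  rewrite /F -mulr_sumr big_split/= -!mulr_sumr !big_split/= -mulr_sumr !sumrB -mulr_sumr sc.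
  by rewrite sumrN sc !sumr_const card_ord -[s ^+ 4 *+ n]mulr_natl; ring.
rewrite S le_eqVlt; apply/orP; left; apply/eqP; field.
by rewrite gt_eqF.
Qed.

End averaged_density.

(** * Admissibility of the competitors *)

Section ball_limits.
Context {R : realType} {n : nat}.
Local Notation mu := (@lebesgue_rV R n.+2).
Local Notation B := (@unit_ball R n.+2).
Implicit Types (x : 'rV[R]_n.+2) (f g h phi : 'rV[R]_n.+2 -> R).
Let mB : measurable B := measurable_unit_ball.

Lemma ae_ball_neq0 (P : 'rV[R]_n.+2 -> Prop) : (forall x, x != 0 -> P x) -> {ae mu, forall x, P x}.
Proof.
move=> Px; exists [set (0 : 'rV[R]_n.+2)].
split; [exact: measurable_rV_origin|exact: lebesgue_rV_origin|].
by move=> x /=; apply: contra_notP => /eqP; exact: Px.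
Qed.

Lemma ball_integrable_le_neq0 f h : measurable_fun B f ->
  (forall x, x != 0 -> B x -> `|f x| <= h x) -> ball_integrable h -> ball_integrable f.
Proof.
move=> mf fh ih; have m0 := @measurable_rV_origin R n.+2.
apply/(negligible_integrable m0 mB _ (@lebesgue_rV_origin R n.+1)); first exact/measurable_EFinP.
apply: (@le_integrable _ _ _ _ _ _ _ (EFin \o h)).
- exact: measurableD.
- by apply/measurable_EFinP; apply: measurable_funS mf => //; exact: subDsetl.
- by move=> x [Bx /eqP x0] /=; rewrite lee_fin (le_trans (fh x x0 Bx))// ler_norm.
- by move: ih; apply: (integrableS mB); [exact: measurableD|exact: subDsetl].
Qed.

Lemma cvg_ball_integral0 (g_ : nat -> 'rV[R]_n.+2 -> R) h :
  (forall m, measurable_fun B (g_ m)) ->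
  (forall x, x != 0 -> B x -> g_ ^~ x @ \oo --> (0 : R)) ->
  (forall m x, x != 0 -> B x -> `|g_ m x| <= h x) -> ball_integrable h ->
  (\int[mu]_(x in B) (g_ m x)%:E)%E @[m --> \oo] --> 0%E.
Proof.
move=> mg g0 gh ih.
have [] := @dominated_convergence _ _ R mu B mB (fun m x => (g_ m x)%:E) (cst 0%E) (EFin \o h).
- by move=> m; exact/measurable_EFinP.
- exact: measurable_cst.
- apply: ae_ball_neq0 => x x0 Bx; apply: cvg_EFin; first by near=> m.
  exact: g0.
- exact: ih.
- by apply: ae_ball_neq0 => x x0 m Bx; rewrite /= lee_fin; exact: gh.
- by move=> _ _; rewrite integral0.
Unshelve. all: by end_near.
Qed.

(** The open ball is not compact; the closed cube around it is. *)
Lemma continuous_ball_bounded f : continuous f -> exists C, forall x, B x -> `|f x| <= C.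
Proof.
move=> cf.
have cK : compact [set x : 'rV[R]_n.+2 | forall i, `[-1, 1]%classic (x ord0 i)].
  by apply: (@rV_compact R n.+2 (fun=> `[-1, 1]%classic)) => i; exact: segment_compact.
have /compact_bounded[M [_ fM]] :
    compact (f @` [set x : 'rV[R]_n.+2 | forall i, `[-1, 1]%classic (x ord0 i)]).
  by apply: continuous_compact => //; exact: continuous_subspaceT.
exists (M + 1) => x Bx; apply: (fM (M + 1)); first by rewrite ltrDl.
by exists x => //; exact: unit_ball_sub_box.
Qed.

Lemma test_function_sphere0 phi x : test_function phi -> sqnorm x = 1 -> phi x = 0.
Proof.
move=> [_ _ sub] x1; apply/eqP; apply: contraT => px.
have : unit_ball x by apply: sub; exact: subset_closure.
by rewrite unit_ballE /= x1 ltxx.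
Qed.

Lemma test_function_has_grad phi x : test_function phi ->
  has_grad phi x (fun j => partial j phi x).
Proof. by move=> [/(_ 1%N)[d _] _ _]; split => //; exact: d. Qed.

Lemma test_function_cont phi : test_function phi -> continuous phi.
Proof. by move=> [/(_ 0%N) c _ _]; exact: c. Qed.

Lemma test_function_cont_partial phi j : test_function phi -> continuous (partial j phi).
Proof. by move=> [/(_ 1%N)[_ c] _ _]; exact: c. Qed.

(** [integral_partial0] applies to the product of [f] and [phi], which vanishes on the sphere. Its
    lines avoid the origin, so the singularity contributes no boundary term. *)
Lemma weak_gradient_punctured f (df : 'I_n.+2 -> 'rV[R]_n.+2 -> R) C h :
  (forall x, x != 0 -> has_grad f x (df ^~ x)) ->
  (forall j x, x != 0 -> {for x, continuous (df j)}) ->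
  measurable_fun B f -> (forall j, measurable_fun B (df j)) ->
  (forall x, B x -> `|f x| <= C) ->
  (forall j x, x != 0 -> B x -> `|df j x| <= h x) -> ball_integrable h ->
  weak_gradient f (fun x => \row_j df j x).
Proof.
move=> fdf cdf mf mdf fC dfh ih j phi tphi.
have mphi : measurable_fun B phi.
  by apply: measurable_funTS; apply: continuous_measurable_rV; exact: test_function_cont.
have mdphi : measurable_fun B (partial j phi).
  by apply: measurable_funTS; apply: continuous_measurable_rV; exact: test_function_cont_partial.
have [C1 phiC] := continuous_ball_bounded (test_function_cont tphi).
have [C2 dphiC] := continuous_ball_bounded (test_function_cont_partial (j := j) tphi).
have i1 : ball_integrable (fun x => f x * partial j phi x).
  apply: (@ball_integrable_bounded _ _ (C * C2)); first exact: measurable_funM.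
  by move=> x Bx; apply: normM_le; [exact: fC|exact: dphiC].
have i2 : ball_integrable (fun x => df j x * phi x).
  apply: (@ball_integrable_le_neq0 _ (fun x => C1 * h x)); first exact: measurable_funM.
    by move=> x x0 Bx; rewrite [leRHS]mulrC; apply: normM_le; [exact: dfh|exact: phiC].
  exact: ball_integrableZ.
under [in RHS]eq_Rintegral => x _ do rewrite mxE.
apply/eqP; rewrite -addr_eq0 -RintegralD//; apply/eqP.
rewrite /Rintegral -[RHS]/(fine 0); congr fine.
apply: (@integral_partial0 R n j (fun x => f x * phi x)).
- move=> x x0; have := has_gradM (fdf x x0) (test_function_has_grad x tphi).
  move=> /(has_grad_is_derive j).
  by rewrite [phi x * _]mulrC.
- move=> x x0.
  have cp : {for x, continuous phi} by exact: test_function_cont.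
  have cdp : {for x, continuous (partial j phi)} by exact: test_function_cont_partial.
  apply: contD; apply: contM => //; last exact: cdf.
  exact: has_grad_continuous (fdf x x0).
- by move=> x x1; rewrite (test_function_sphere0 tphi x1) mulr0.
- by apply: ball_integrable_eq (ball_integrableD i1 i2).
Qed.

End ball_limits.

Section admissibility.
Context {R : realType} {n : nat}.
Local Notation mu := (@lebesgue_rV R n.+2).
Local Notation B := (@unit_ball R n.+2).
Local Notation N := (n.+2%:R : R).
Variables (k : 'I_n.+2) (s : R).
Hypotheses (n0 : (0 < n)%N) (s1 : `|s| <= 1).
Implicit Types (x : 'rV[R]_n.+2) (i j : 'I_n.+2).
Let mB : measurable B := measurable_unit_ball.

Let ball_le1 x : B x -> sqnorm x <= 1.
Proof. by rewrite unit_ballE => /ltW. Qed.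

Lemma ball_integrable_isq C : ball_integrable (fun x => C * isq (sqnorm x)).
Proof.
apply: ball_integrableZ; apply: ball_integrable_powR.
by rewrite (_ : N + 2 * - 2^-1 = n.+1%:R) ?ltr0n// -[in LHS]natr1; field.
Qed.

(** Square integrability of 1/|x| takes dimension at least 3, which is where [0 < n] enters. *)
Lemma ball_integrable_sqr_isq C : ball_integrable (fun x => (C * isq (sqnorm x)) ^+ 2).
Proof.
have -> : (fun x : 'rV[R]_n.+2 => (C * isq (sqnorm x)) ^+ 2) = (fun x => C ^+ 2 * sqnorm x `^ (-1)).
  by apply/funext => x; rewrite exprMn sqr_isq ?sqnorm_ge0// powR_inv1// sqnorm_ge0.
apply: ball_integrableZ; apply: ball_integrable_powR.
by rewrite (_ : N + 2 * - 1 = n%:R) ?ltr0n// -2![in LHS]natr1; ring.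
Qed.

Lemma L2_ball_cu i : L2_ball (cu k s 0 i).
Proof.
split; first exact: measurable_cu.
apply: integrable_lty => //.
apply: (@ball_integrable_bounded _ _ (3 ^+ 2)).
  by apply: measurable_funX; exact: measurable_cu.
move=> x /ball_le1 x1; rewrite normrX lerXn2r ?nnegrE//.
exact: cu_le3.
Qed.

Lemma L2_ball_dcu i j : L2_ball (dcu k s 0 i j).
Proof.
split; first exact: measurable_dcu.
apply: integrable_lty => //.
apply: (@ball_integrable_le_neq0 _ _ _ (fun x => (32 * isq (sqnorm x)) ^+ 2)).
- by apply: measurable_funX; exact: measurable_dcu.
- move=> x x0 /ball_le1 x1; rewrite normrX lerXn2r ?nnegrE ?mulr_ge0 ?isq_ge0//.
  exact: dcu_le.
- exact: ball_integrable_sqr_isq.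
Qed.

Lemma weak_gradient_cu i : weak_gradient (cu k s 0 i) (fun x => row i (dcmap k s 0 x)).
Proof.
have -> : (fun x : 'rV[R]_n.+2 => row i (dcmap k s 0 x)) = (fun x => \row_j dcu k s 0 i j x).
  by apply/funext => x; apply/rowP => j; rewrite !mxE.
have xe x : x != 0 -> 0 < sqnorm x + 0 by rewrite addr0 sqnorm_gt0.
apply: (@weak_gradient_punctured _ _ _ (fun j => dcu k s 0 i j) 3 (fun x => 32 * isq (sqnorm x))).
- by move=> x /xe x0; exact: has_grad_cu.
- move=> j x /xe x0; apply: (cont_dcu (X := id) (E := fun=> 0)) => //.
    by move=> l; exact: cont_coord.
  exact: cont_cst.
- exact: measurable_cu.
- by move=> j; exact: measurable_dcu.
- by move=> x /ball_le1 x1; exact: cu_le3.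
- by move=> j x x0 /ball_le1 x1; exact: dcu_le.
- exact: ball_integrable_isq.
Qed.

Lemma partial_cu (e : R) i j x : 0 < e -> partial j (cu k s e i) x = dcu k s e i j x.
Proof.
move=> e0; have xe : 0 < sqnorm x + e by rewrite ltr_wpDl// sqnorm_ge0.
by have [_ +] := has_grad_cu k s (ltW e0) xe i; apply.
Qed.

Lemma classC1_cu (e : R) i : 0 < e -> classC 1 (cu k s e i).
Proof.
move=> e0; have xe x : 0 < sqnorm x + e by rewrite ltr_wpDl// sqnorm_ge0.
have g x := has_grad_cu k s (ltW e0) (xe x) i.
split=> [x|j]; first by have [] := g x.
rewrite (_ : partial j _ = dcu k s e i j); last by apply/funext => x; exact: partial_cu.
move=> x /=; apply: (cont_dcu (X := id) (E := fun=> e)) => //.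
- by move=> l; exact: cont_coord.
- exact: cont_cst.
- exact: ltW.
Qed.

Let h m : R := m.+1%:R^-1.
Let h0 m : 0 < h m. Proof. by rewrite invr_gt0. Qed.

Lemma cvg_cu i x : x != 0 -> (fun m => cu k s (h m) i x) @ \oo --> cu k s 0 i x.
Proof.
move=> x0; have : {for (0 : R), continuous (fun e => cu k s e i x)}.
  apply: (cont_cu (X := fun=> x) (E := id)) => //; last by rewrite addr0 sqnorm_gt0.
  by move=> l; exact: cont_cst.
move/(@continuous_cvg _ _ _ _ _ h (fun e => cu k s e i x) 0); apply.
exact: cvg_harmonic.
Qed.

Lemma cvg_dcu i j x : x != 0 -> (fun m => dcu k s (h m) i j x) @ \oo --> dcu k s 0 i j x.
Proof.
move=> x0; have : {for (0 : R), continuous (fun e => dcu k s e i j x)}.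
  apply: (cont_dcu (X := fun=> x) (E := id)) => //; last by rewrite addr0 sqnorm_gt0.
  by move=> l; exact: cont_cst.
move/(@continuous_cvg _ _ _ _ _ h (fun e => dcu k s e i j x) 0); apply.
exact: cvg_harmonic.
Qed.

Lemma cvg_sqr_sub0 (u : nat -> R) (l : R) :
  u @ \oo --> l -> (fun m => (u m - l) ^+ 2) @ \oo --> (0 : R).
Proof.
move=> ul; rewrite -[X in _ --> X](_ : (l - l) ^+ 2 = 0); last by rewrite subrr expr0n.
have c : {for (l : R), continuous (fun t => (t - l) ^+ 2)}.
  by apply: contX; apply: contB; [exact: cvg_id|exact: cont_cst].
exact: continuous_cvg c ul.
Qed.

Lemma isq_enorm x : (enorm x)^-1 = isq (sqnorm x).
Proof. by rewrite /enorm -/(sqnorm x) /isq powRN powR12_sqrt// sqnorm_ge0. Qed.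

Lemma radial_projE x i : radial_proj x ord0 i = cy 0 i x.
Proof. by rewrite mxE isq_enorm /cy /cw addr0 mulrC. Qed.

Lemma sqnorm_radial_proj x : x != 0 -> sqnorm (radial_proj x) = 1.
Proof.
by move=> x0; rewrite -(sum_sqr_cy0 x0); apply: eq_bigr => i _; rewrite radial_projE.
Qed.

Lemma measurable_radial_proj : measurable_fun setT (@radial_proj R n.+2).
Proof.
apply: measurable_fun_rVP => i.
rewrite (_ : _ \o _ = cy 0 i); first exact: measurable_cy.
by apply/funext => x /=; rewrite /rV_coord radial_projE.
Qed.

Lemma cu_sphere x i : sqnorm x = 1 -> cu k s 0 i x = x ord0 i.
Proof.
move=> x1; rewrite /cu /cM /cv /cf /cy /cw x1 subrr addr0 isq1 expr0n/= !(mul0r, mulr0) !addr0.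
by rewrite expr0n/= !(mul0r, mulr0) addr0 isq1 !mulr1.
Qed.

Lemma has_trace_cu i :
  has_trace (cu k s 0 i) (fun x => row i (dcmap k s 0 x)) (fun x => x ord0 i).
Proof.
exists (fun m => cu k s (h m) i); split.
- by move=> m; exact: classC1_cu.
- apply: (@cvg_ball_integral0 _ _ _ (fun=> (3 + 3) ^+ 2)).
  + by move=> m; apply: measurable_funX; apply: measurable_funB; exact: measurable_cu.
  + by move=> x x0 _; apply: cvg_sqr_sub0; exact: cvg_cu.
  + move=> m x x0 /ball_le1 x1; rewrite normrX lerXn2r ?nnegrE//.
    by apply: normB_le; apply: cu_le3 => //; exact: ltW.
  + exact: ball_integrable_cst.
- move=> j.
  under eq_fun do under eq_integral do rewrite [row i _ _ _]mxE [dcmap _ _ _ _ _ _]mxE.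
  apply: (@cvg_ball_integral0 _ _ _ (fun x => (64 * isq (sqnorm x)) ^+ 2)).
  + move=> m; apply: measurable_funX; apply: measurable_funB; last exact: measurable_dcu.
    by apply: measurable_funTS; apply: continuous_measurable_rV;
      have [_ +] := classC1_cu i (h0 m); apply.
  + move=> x x0 _.
    under eq_fun do rewrite partial_cu//.
    by apply: cvg_sqr_sub0; exact: cvg_dcu.
  + move=> m x x0 /ball_le1 x1.
    rewrite partial_cu// normrX lerXn2r ?nnegrE ?mulr_ge0 ?isq_ge0//.
    rewrite (_ : 64 * _ = 32 * isq (sqnorm x) + 32 * isq (sqnorm x)); last by ring.
    by apply: normB_le; apply: dcu_le => //; exact: ltW.
  + exact: ball_integrable_sqr_isq.
- rewrite /sphere_integral -[X in _ --> X](mule0 N%:E).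
  apply: cvgeZl => //.
  have sm (e : R) : measurable_fun B (fun x => cu k s e i (radial_proj x)).
    by apply: measurable_funTS; apply: measurableT_comp;
      [exact: measurable_cu|exact: measurable_radial_proj].
  apply: (@cvg_ball_integral0 _ _ _ (fun=> (3 + 3) ^+ 2)).
  + move=> m; apply: measurable_funX; apply: measurable_funB => //.
    have -> : (fun x : 'rV[R]_n.+2 => radial_proj x ord0 i) = cy 0 i.
      by apply/funext => x; rewrite radial_projE.
    exact: measurable_cy.
  + move=> x x0 _; have x1 := sqnorm_radial_proj x0.
    (* On the sphere f vanishes, so the prescribed value is that of the competitor at e = 0 and
       pointwise convergence in e applies. *)
    rewrite -(cu_sphere i x1); apply: cvg_sqr_sub0; apply: cvg_cu.
    by rewrite -sqnorm_gt0 x1.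
  + move=> m x x0 _; have x1 := sqnorm_radial_proj x0.
    rewrite -(cu_sphere i x1) normrX lerXn2r ?nnegrE//.
    by apply: normB_le; apply: cu_le3 => //; rewrite ?x1// ltW.
  + exact: ball_integrable_cst.
Qed.

Lemma admissible_cmap : admissible (cmap k s 0) (dcmap k s 0).
Proof.
have cE i : (fun x => cmap k s 0 x ord0 i) = cu k s 0 i.
  by apply/funext => x; rewrite mxE.
split; first split.
- move=> i; rewrite cE; split; [exact: L2_ball_cu| |exact: weak_gradient_cu].
  move=> j; rewrite (_ : (fun x => _) = dcu k s 0 i j); first exact: L2_ball_dcu.
  by apply/funext => x; rewrite !mxE.
- by apply: ae_ball_neq0 => x x0 _; exact: enorm_cmap.
- by move=> i; rewrite cE; exact: has_trace_cu.
Qed.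

End admissibility.

(** * Comparison of energies *)

Section energy_comparison.
Context {R : realType} {n : nat}.
Local Notation mu := (@lebesgue_rV R n.+2).
Local Notation B := (@unit_ball R n.+2).
Local Notation N := (n.+2%:R : R).
Implicit Types (x : 'rV[R]_n.+2) (k : 'I_n.+2) (s : R).
Let mB : measurable B := measurable_unit_ball.

Lemma eq_Rintegral_neq0 (f g : 'rV[R]_n.+2 -> R) : measurable_fun B f -> measurable_fun B g ->
  (forall x, x != 0 -> f x = g x) -> \int[mu]_(x in B) f x = \int[mu]_(x in B) g x.
Proof.
move=> mf mg fg; rewrite /Rintegral; congr fine; apply: ae_eq_integral => //.
- exact/measurable_EFinP.
- exact/measurable_EFinP.
- by apply: ae_ball_neq0 => x x0 _; rewrite fg.
Qed.

Lemma cmap0 k : cmap k 0 0 = @radial_proj R n.+2.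
Proof.
apply/funext => x; apply/rowP => i; rewrite mxE radial_projE /cu /cM /cv.
by rewrite expr0n/= !mul0r !addr0 isq1 mulr1.
Qed.

Variable p : R.
Hypotheses (p2 : 2 < p) (pN : p < N).

(** This is |x|^(2j - p) off the origin. With the integer power split off, combinations of these
    functions are polynomials in [sqnorm x] times a common factor, and they vanish at 0 for every j,
    even if 2j = p. *)
Definition moment_fun (j : nat) x : R := sqnorm x `^ (- (p / 2)) * sqnorm x ^+ j.
Definition moment j : R := \int[mu]_(x in B) moment_fun j x.

Lemma weightE x : enorm x `^ (2 - p) = sqnorm x `^ (- (p / 2) + 1).
Proof.
rewrite /enorm -/(sqnorm x) -powR12_sqrt ?sqnorm_ge0// -powRrM.
by congr (_ `^ _); field.
Qed.

Lemma weight_moment x (j : nat) : x != 0 ->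
  enorm x `^ (2 - p) * sqnorm x ^+ j = moment_fun j.+1 x.
Proof.
move=> x0; rewrite weightE powRD ?sqnorm_eq0 ?x0 ?implybT// powRr1 ?sqnorm_ge0//.
by rewrite /moment_fun exprS mulrA.
Qed.

Lemma weight_div x : x != 0 -> enorm x `^ (2 - p) / sqnorm x = moment_fun 0 x.
Proof.
move=> x0; have := weight_moment 0 x0; rewrite expr0 mulr1 => ->.
by rewrite /moment_fun expr1 mulfK ?expr0 ?mulr1// sqnorm_eq0.
Qed.

Lemma measurable_moment_fun j : measurable_fun B (moment_fun j).
Proof.
apply: measurable_funM; first exact: measurable_powR_sqnorm.
by apply: measurable_funX; exact: measurable_sqnorm.
Qed.

Let moment_powR j x : x != 0 -> moment_fun j x = sqnorm x `^ (- (p / 2) + j%:R).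
Proof.
move=> x0; rewrite powRD ?sqnorm_eq0 ?x0 ?implybT//.
by rewrite powR_mulrn ?sqnorm_ge0.
Qed.

Let exponent_gt0 (j : nat) : 0 < N + 2 * (- (p / 2) + j%:R).
Proof.
rewrite (_ : _ + _ = (N - p) + 2 * j%:R); last by field.
by rewrite ltr_pwDl ?subr_gt0// mulr_ge0.
Qed.

Lemma momentE j : moment j = N * @vol R n / (N - p + 2 * j%:R).
Proof.
rewrite /moment (eq_Rintegral_neq0 (measurable_moment_fun j)
  (@measurable_powR_sqnorm R n (- (p / 2) + j%:R) B)).
  by rewrite Rintegral_powR//; congr (_ / _); field.
by move=> x x0; exact: moment_powR.
Qed.

Lemma integrable_moment_fun j : ball_integrable (moment_fun j).
Proof.
apply: (@ball_integrable_le_neq0 _ _ _ (fun x => sqnorm x `^ (- (p / 2) + j%:R))).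
- exact: measurable_moment_fun.
- by move=> x x0 _; rewrite moment_powR// ger0_norm// powR_ge0.
- exact: ball_integrable_powR.
Qed.

Definition density k s x : R := enorm x `^ (2 - p) * hs_norm (dcmap k s 0 x) ^+ 2.

Lemma density_ge0 k s x : 0 <= density k s x.
Proof. by rewrite mulr_ge0 ?powR_ge0 ?sqr_ge0. Qed.

Lemma measurable_density k s : measurable_fun B (density k s).
Proof.
apply: measurable_funM.
  by under eq_fun do rewrite weightE; exact: measurable_powR_sqnorm.
under eq_fun do rewrite sqr_hs_norm.
apply: measurable_sum => i; apply: measurable_sum => j; apply: measurable_funX.
rewrite (_ : (fun x => _) = dcu k s 0 i j); first exact: measurable_dcu.
by apply/funext => x; rewrite mxE.
Qed.

Lemma integrable_density k s : `|s| <= 1 -> ball_integrable (density k s).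
Proof.
move=> s1; apply: (@ball_integrable_le_neq0 _ _ _ (fun x => N * (N * 32 ^+ 2) * moment_fun 0 x)).
- exact: measurable_density.
- move=> x x0; rewrite unit_ballE => /ltW x1.
  rewrite ger0_norm ?density_ge0// -weight_div// mulrCA; apply: ler_wpM2l; first exact: powR_ge0.
  rewrite sqr_hs_norm (_ : N * _ / _ = N * (N * (32 ^+ 2 * (sqnorm x)^-1))); last by ring.
  have le1 i j : (dcmap k s 0 x) i j ^+ 2 <= 32 ^+ 2 * (sqnorm x)^-1.
    rewrite mxE -sqr_isq ?sqnorm_ge0// -exprMn -real_normK ?num_real//.
    rewrite lerXn2r ?nnegrE ?mulr_ge0 ?isq_ge0//.
    exact: dcu_le.
  have sumc (c : R) : \sum_(i < n.+2) c = N * c by rewrite sumr_const card_ord mulr_natl.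
  by rewrite -!sumc; apply: ler_sum => i _; apply: ler_sum => j _.
- by apply: ball_integrableZ; exact: integrable_moment_fun.
Qed.

Lemma energy_dcmap k s : `|s| <= 1 ->
  energy p (dcmap k s 0) = (\int[mu]_(x in B) density k s x)%:E.
Proof.
move=> s1; rewrite /Rintegral fineK//; apply: integrable_fin_num => //.
exact: integrable_density.
Qed.

Lemma Rintegral_density0 k : \int[mu]_(x in B) density k 0 x = (N - 1) * moment 0.
Proof.
rewrite -RintegralZl//; last exact: integrable_moment_fun.
apply: eq_Rintegral_neq0.
- exact: measurable_density.
- by apply: measurable_funM => //; exact: measurable_moment_fun.
- by move=> x x0; rewrite /density hs_norm_dcmap0// -weight_div// mulrCA.
Qed.

(** The integrand r^(2-p) f'^2 - (n - 3) r^(-p) f^2 of Q, with 16 q (1 - q)^2 and (1 - q)^4, q =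
    |x|^2, expanded into powers of q; hence the binomial coefficients. *)
Definition variation_fun x : R :=
  16 * (moment_fun 2 x + (- 2 * moment_fun 3 x + moment_fun 4 x)) +
  - (N - 3) * (moment_fun 0 x + (- 4 * moment_fun 1 x + (6 * moment_fun 2 x +
     (- 4 * moment_fun 3 x + moment_fun 4 x)))).

Definition variation : R :=
  16 * (moment 2 + (- 2 * moment 3 + moment 4)) +
  - (N - 3) * (moment 0 + (- 4 * moment 1 + (6 * moment 2 +
     (- 4 * moment 3 + moment 4)))).

Let RintD (f g : 'rV[R]_n.+2 -> R) : ball_integrable f -> ball_integrable g ->
  \int[mu]_(x in B) (f x + g x) = \int[mu]_(x in B) f x + \int[mu]_(x in B) g x.
Proof. by move=> ? ?; rewrite RintegralD. Qed.

Let RintZ (f : 'rV[R]_n.+2 -> R) c : ball_integrable f ->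
  \int[mu]_(x in B) (c * f x) = c * \int[mu]_(x in B) f x.
Proof. by move=> ?; rewrite RintegralZl. Qed.

Lemma integrable_variation_fun : ball_integrable variation_fun.
Proof.
by do ![apply: ball_integrableD | apply: ball_integrableZ | exact: integrable_moment_fun].
Qed.

Lemma Rintegral_variation : \int[mu]_(x in B) variation_fun x = variation.
Proof.
rewrite /variation /variation_fun.
by rewrite !(RintD, RintZ)//;
  do ![apply: ball_integrableD | apply: ball_integrableZ | exact: integrable_moment_fun].
Qed.

(** The alternating binomial sums of 1/(q + 2j) are finite differences: the one over j = 2, 3, 4 has
    numerator 2^2 2! = 8, the one over j = 0, ..., 4 has 2^4 4! = 384. So 16 * 8 = 128 and 384 = 3 *
    128 give the common factor 128 and the 3 in 3 (N - 3). *)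
Lemma variation_lt0 : 6 <= N -> N - 21 / 10 < p -> p < N - 2 -> variation < 0.
Proof.
move=> N6 p1 p3; rewrite /variation !momentE.
have [q qE] : exists q, q = N - p by exists (N - p).
rewrite -qE; set V := N * vol.
have V0 : 0 < V by rewrite mulr_gt0// vol_gt0.
have q2 : 2 < q by rewrite qE; lra.
have q3 : q < 21 / 10 by rewrite qE; lra.
have D0 : 0 < q * (q + 2) * (q + 4) * (q + 6) * (q + 8) by rewrite !mulr_gt0//; lra.
have -> : 16 * (V / (q + 2 * 2%:R) + (- 2 * (V / (q + 2 * 3%:R)) + V / (q + 2 * 4%:R))) +
  - (N - 3) * (V / (q + 2 * 0%:R) + (- 4 * (V / (q + 2 * 1%:R)) + (6 * (V / (q + 2 * 2%:R)) +
     (- 4 * (V / (q + 2 * 3%:R)) + V / (q + 2 * 4%:R))))) =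
  V * (128 * (q * (q + 2) - 3 * (N - 3))) / (q * (q + 2) * (q + 4) * (q + 6) * (q + 8)).
  by field; do ![apply/andP; split]; apply: lt0r_neq0; lra.
rewrite pmulr_llt0 ?invr_gt0// pmulr_rlt0// pmulr_rlt0//.
have : q * (q + 2) < 21 / 10 * (41 / 10) by apply: ltr_pM; lra.
lra.
Qed.

Lemma ball_integrable_sum m (F : 'I_m -> 'rV[R]_n.+2 -> R) :
  (forall l, ball_integrable (F l)) -> ball_integrable (fun x => \sum_l F l x).
Proof.
elim: m F => [|m IH] F iF.
  under eq_fun do rewrite big_ord0; exact: ball_integrable_cst.
by under eq_fun do rewrite big_ord_recl; apply: ball_integrableD => //; exact: IH.
Qed.

Lemma Rintegral_sum m (F : 'I_m -> 'rV[R]_n.+2 -> R) :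
  (forall l, ball_integrable (F l)) ->
  \sum_l \int[mu]_(x in B) F l x = \int[mu]_(x in B) (\sum_l F l x).
Proof.
elim: m F => [|m IH] F iF.
  under eq_Rintegral do rewrite big_ord0.
  by rewrite big_ord0 (Rintegral_cst mu mB 0) mul0r.
under [RHS]eq_Rintegral do rewrite big_ord_recl.
by rewrite big_ord_recl RintD ?IH//; exact: ball_integrable_sum.
Qed.

(** The integrands in [sum_energy_le] are compared at every point of the ball, so their conventional
    values at 0 have to agree. For [density_0] this rests on [2 < p], which makes the exponent of
    the weight nonzero. *)
Lemma moment_fun_0 j : moment_fun j 0 = 0.
Proof.
rewrite /moment_fun (_ : sqnorm 0 = 0) ?powR0 ?mul0r//; last by apply/eqP; rewrite sqnorm_eq0.
by rewrite oppr_eq0 gt_eqF// divr_gt0// (lt_trans _ p2).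
Qed.

Lemma density_0 k s : density k s 0 = 0.
Proof.
rewrite /density weightE (_ : sqnorm 0 = 0) ?powR0 ?mul0r//; last by apply/eqP; rewrite sqnorm_eq0.
by rewrite lt_eqF// addrC subr_lt0 ltr_pdivlMr// mul1r.
Qed.

Lemma sum_energy_le s : `|s| <= 1 ->
  \sum_k (\int[mu]_(x in B) density k s x + \int[mu]_(x in B) density k (- s) x) <=
  2 * (N - 1) * (N * moment 0 + (s ^+ 2 * variation + N * s ^+ 4 * moment 0)).
Proof.
move=> s1; have s1' : `|- s| <= 1 by rewrite normrN.
have im := integrable_moment_fun; have iv := integrable_variation_fun.
have iG : ball_integrable (fun x => 2 * (N - 1) * (N * moment_fun 0 x +
    (s ^+ 2 * variation_fun x + N * s ^+ 4 * moment_fun 0 x))).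
  by do ![apply: ball_integrableD | apply: ball_integrableZ | exact: im | exact: iv].
have -> : 2 * (N - 1) * (N * moment 0 + (s ^+ 2 * variation + N * s ^+ 4 * moment 0)) =
    \int[mu]_(x in B) (2 * (N - 1) * (N * moment_fun 0 x +
    (s ^+ 2 * variation_fun x + N * s ^+ 4 * moment_fun 0 x))).
  rewrite -Rintegral_variation !(RintD, RintZ)//;
  by do ![apply: ball_integrableD | apply: ball_integrableZ | exact: im | exact: iv].
have id k : ball_integrable (fun x => density k s x + density k (- s) x).
  by apply: ball_integrableD; exact: integrable_density.
under eq_bigr do rewrite -RintD ?integrable_density//.
rewrite (Rintegral_sum id); apply: le_Rintegral => //; first exact: ball_integrable_sum.
move=> x Bx.
have [->|xn0] := eqVneq x 0.
  rewrite big1 => [|k _]; last by rewrite !density_0 addr0.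
  by rewrite /variation_fun !moment_fun_0 !(mulr0, addr0).
have -> : \sum_k (density k s x + density k (- s) x) = enorm x `^ (2 - p) *
    \sum_k (hs_norm (dcmap k s 0 x) ^+ 2 + hs_norm (dcmap k (- s) 0 x) ^+ 2).
  by rewrite mulr_sumr; apply: eq_bigr => k _; rewrite mulrDr.
have x1 : sqnorm x <= 1 by move: Bx; rewrite unit_ballE => /ltW.
apply: le_trans (ler_wpM2l (powR_ge0 _ _) (sum_density_le _ xn0 x1 s1)) _ => //.
rewrite le_eqVlt; apply/orP; left; apply/eqP.
rewrite /variation_fun -!weight_moment// -(weight_div xn0) /cf.
have q0 : sqnorm x != 0 by rewrite sqnorm_eq0.
by field.
Qed.

End energy_comparison.

Unset Implicit Arguments.

Theorem corollary0p1 (R : realType) (n : nat) (hn : (6 <= n)%N) :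
  exists p0 : R, [/\ n%:R - 3 < p0, p0 < n%:R - 2 &
    forall p : R, p0 < p -> p < n%:R - 2 ->
      exists Du0 : 'rV[R]_n -> 'M[R]_n,
        admissible (@radial_proj R n) Du0 /\
        ~ minimizes p (@radial_proj R n) Du0].
Proof.
case: n hn => [//|[//|n]] hn.
have N6 : 6 <= n.+2%:R :> R by rewrite (ler_nat R 6).
exists (n.+2%:R - 21 / 10); split => [||p p1 p3]; [lra|lra|].
have n0 : (0 < n)%N by exact: (@leq_trans 4 1 n isT hn).
have p2 : 2 < p by move: N6 p1; set N := n.+2%:R => N6 p1; lra.
have pN : p < n.+2%:R by move: N6 p3; set N := n.+2%:R => N6 p3; lra.
have adm (k : 'I_n.+2) (s : R) : `|s| <= 1 -> admissible (cmap k s 0) (dcmap k s 0).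
  by move=> s1; exact: admissible_cmap.
have z1 : `|0 : R| <= 1 by rewrite normr0.
(* At s = 0 every direction k gives back u0, so [ord0] is an arbitrary choice. *)
exists (dcmap ord0 0 0); split; first by rewrite -(cmap0 ord0); exact: adm.
move=> [_ min0].
pose e (k : 'I_n.+2) (s : R) := \int[lebesgue_rV n.+2]_(x in unit_ball) density p k s x.
have min_le (k : 'I_n.+2) (s : R) : `|s| <= 1 -> (n.+2%:R - 1) * @moment R n p 0 <= e k s.
  move=> s1; rewrite -(Rintegral_density0 pN ord0) -lee_fin -!energy_dcmap//.
  exact: min0 (adm k s s1).
have V0 := variation_lt0 pN N6 p1 p3.
have m0 : 0 < @moment R n p 0.
  by rewrite momentE// divr_gt0 ?mulr_gt0 ?vol_gt0// mulr0 addr0 subr_gt0.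
set V := @variation R n p in V0; set m := @moment R n p 0 in m0 min_le.
pose K : R := n.+2%:R * m.
have K0 : 0 < K by rewrite mulr_gt0.
(* The bracket V + s^2 K is to be negative: s <= 1 gives s^2 K <= s K, and the second bound gives s
   K <= -V/2. *)
pose s := Num.min 1 (- V / (2 * K)).
have s0 : 0 < s by rewrite lt_min ltr01 divr_gt0 ?oppr_gt0// mulr_gt0.
have sle1 : s <= 1 by rewrite ge_min lexx.
have sleV : s * (2 * K) <= - V by rewrite -ler_pdivlMr ?mulr_gt0// ge_min lexx orbT.
have s1 : `|s| <= 1 by rewrite ger0_norm// ltW.
(* No single better competitor is exhibited: minimality bounds each of the 2n energies from below by
   that of u0, and the sum of these bounds contradicts the averaged estimate. *)
have := sum_energy_le p2 pN s1; apply/negP; rewrite -ltNge -/V -/m.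
apply: (@lt_le_trans _ _ (\sum_(k < n.+2) ((n.+2%:R - 1) * m + (n.+2%:R - 1) * m))); last first.
  by apply: ler_sum => k _; apply: lerD; apply: min_le; rewrite ?normrN.
rewrite sumr_const card_ord.
have -> : ((n.+2%:R - 1) * m + (n.+2%:R - 1) * m) *+ n.+2 = 2 * (n.+2%:R - 1) * (n.+2%:R * m).
  by rewrite -[LHS]mulr_natl; ring.
have N1 : 0 < n.+2%:R - 1 :> R by rewrite subr_gt0 ltr1n.
rewrite ltr_pM2l ?mulr_gt0// gtrDl.
have -> : s ^+ 2 * V + n.+2%:R * s ^+ 4 * m = s ^+ 2 * (V + s ^+ 2 * K) by rewrite /K; ring.
rewrite pmulr_rlt0 ?exprn_gt0//.
have sK : s ^+ 2 * K <= s * K by rewrite ler_pM2r// expr2 ger_pMl.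
have : 0 < s * K by rewrite mulr_gt0.
lra.
Qed.
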